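(* Assume $\mathsf{MA}_{\aleph_1}$. If $C$ is a normal Countryman line, then $A\times C\cong C$ for every nonempty linear order $A$ with $A\preceq C$. In particular, $C$ is strongly surjective.
   Context: For linear orders, $A\preceq B$ means that there is a monotone injection $A\to B$. $B\trianglelefteq A$ means that $B=\varnothing$ or there is a surjective monotone map ($x\le y$ implies $f(x)\le f(y)$) from $A$ onto $B$. A linear order $A$ is strongly surjective if $B\trianglelefteq A$ whenever $B$ is a suborder of $A$. $A\times C$ denotes the product with the lexicographic order (first coordinate compared first, i.e. each point of $A$ is replaced by a copy of $C$). A nonempty linear order $A$ is $\aleph_1$-dense if it has no left or right endpoint and $[a,b]_A$ has size $\aleph_1$ for all $a<_A b$. A Countryman line is an uncountable linear order $C$ such that $C^2$, with the coordinatewise product order, is a union of countably many chains. Every Countryman line is an Aronszajn line (an uncountable linear order containing no copy of $\omega_1$, $\omega_1^{\star}$, or any uncountable set of reals). A decomposition for an Aronszajn line $A$ is a $\subseteq$-increasing sequence $\langle D_\xi:\xi<\omega_1\rangle$ of countable subsets of $A$ which covers $A$ and is continuous (unions at limits). The complementary intervals of $A\setminus D_\xi$ are the intervals (nonempty convex subsets) of $A$ that are maximal with respect to not having points in $D_\xi$. An Aronszajn line $A$ is non-stationary if it has a decomposition $\langle D_\xi:\xi<\omega_1\rangle$ such that for every $\xi<\omega_1$ every complementary interval of $A\setminus D_\xi$ has no endpoints (no minimum and no maximum). $A$ is normal if it is non-stationary and $\aleph_1$-dense. *)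

(* Defs.v *)
From HB Require Import structures.
From mathcomp Require Import all_boot all_order.
From mathcomp Require Import boolp classical_sets functions cardinality.
From mathcomp Require wochoice.

Set Implicit Arguments.
Unset Strict Implicit.
Unset Printing Implicit Defensive.

Import Order.TTheory.
Local Open Scope classical_set_scope.
Local Open Scope card_scope.
Local Open Scope order_scope.

HB.instance Definition _ (d : Order.disp_t) (A : orderType d) (B : set A) :=
  SubChoice.on (set_type B).
HB.instance Definition _ (d : Order.disp_t) (A : orderType d) (B : set A) :=
  [SubChoice_isSubOrder of set_type B by <: with d].

(* omega_1 is realized as the set of points having only countably many
   predecessors in some well-ordering of the power set of nat. Any choice of
   that well-ordering gives the same order type: by the lemmas
   omega1_well_founded, omega1_countable_lt and omega1_uncountable it is an
   uncountable well-order all of whose proper initial segments are countable. *)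

Definition wo_powerset : Type := set nat.

HB.instance Definition _ := Choice.on wo_powerset.

Definition wo_powerset_le : rel wo_powerset :=
  sval (wochoice.well_ordering_principle wo_powerset).

Lemma wo_powerset_leP : wochoice.well_order wo_powerset_le.
Proof. exact: svalP. Qed.

Lemma wo_powerset_min (X : set wo_powerset) : X !=set0 ->
  exists2 m, X m & forall x, X x -> wo_powerset_le m x.
Proof.
move=> [x0 Xx0].
have [|m [[/asboolP Xm mP] _]] :=
    wo_powerset_leP (A := fun x => `[< X x >]).
  by exists x0; apply/asboolP.
by exists m => // x Xx; apply: mP; apply/asboolP.
Qed.

Lemma wo_powerset_le_total : total wo_powerset_le.
Proof.
move=> x y; have [|m] := @wo_powerset_min [set x; y]; first by exists x; left.
by move=> [|] -> mP; apply/orP; [left|right]; apply: mP; [right|left].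
Qed.

Lemma wo_powerset_le_anti : antisymmetric wo_powerset_le.
Proof.
move=> x y /andP[xy yx].
have rfl z : wo_powerset_le z z.
  by have := wo_powerset_le_total z z; rewrite orbb.
have [|m [_ mP]] := wo_powerset_leP (A := pred2 x y).
  by exists x; rewrite inE eqxx.
rewrite -(mP x) ?(mP y) //; split; rewrite ?inE ?eqxx ?orbT //.
  by move=> z; rewrite inE => /orP[] /eqP ->.
by move=> z; rewrite inE => /orP[] /eqP ->.
Qed.

Lemma wo_powerset_le_trans : transitive wo_powerset_le.
Proof.
move=> y x z xy yz.
have [|m [->|[->|->]] mP] := @wo_powerset_min [set t | t = x \/ t = y \/ t = z].
- by exists x; left.
- by apply: mP; do 2 right.
- have -> : x = y by apply: wo_powerset_le_anti; rewrite xy mP //; left.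
  exact: yz.
- have <- : y = z by apply: wo_powerset_le_anti; rewrite yz mP //; right; left.
  exact: xy.
Qed.

HB.instance Definition _ :=
  @Order.isOrder.Build (Order.Disp tt tt) wo_powerset
    wo_powerset_le _ _ _ (fun _ _ => erefl) (fun _ _ => erefl)
    (fun _ _ => erefl)
    wo_powerset_le_anti wo_powerset_le_trans wo_powerset_le_total.

Definition omega1 : Type :=
  set_type [set x : wo_powerset | countable [set y | y < x]].

HB.instance Definition _ := Order.Total.on omega1.

Lemma omega1_well_founded (X : set omega1) :
  X !=set0 -> exists2 m, X m & forall x, X x -> m <= x.
Proof.
move=> [x0 Xx0]; have [|_ [m Xm <-] mP] := @wo_powerset_min (val @` X).
  by exists (val x0), x0.
by exists m => // x Xx; apply: mP; exists x.
Qed.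

Lemma omega1_countable_lt (x : omega1) : countable [set y | y < x].
Proof.
have /set_mem/countable_injP[f f_inj] := valP x.
apply/countable_injP; exists (f \o val) => y z /set_mem yx /set_mem zx fyz.
by apply: val_inj; apply: f_inj => //; apply: mem_set.
Qed.

Lemma omega1_uncountable : ~~ countable [set: omega1].
Proof.
apply/negP => /countable_injP[f f_inj].
pose S := [set x : wo_powerset | countable [set y | y < x]].
have cS : countable S.
  apply/countable_injP; exists (fun x => if pselect (S x) is left Sx
    then f (SigSub (mem_set Sx)) else 0%N).
  move=> x y /set_mem Sx /set_mem Sy.
  case: pselect => // Sx'; case: pselect => // Sy' /f_inj.
  by rewrite !in_setT => /(_ isT isT) /(congr1 val).
have [ST|] := eqVneq S setT.
  move: cS; rewrite ST => /countable_injP[g g_inj].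
  pose A : wo_powerset := [set n | exists2 X, g X = n & ~ (X : set nat) n].
  have : ~ (A : set nat) (g A).
    move=> [X gXA XA]; apply: (XA).
    have -> : X = A by apply: g_inj; rewrite ?in_setT.
    by exists X.
  by move=> nA; apply: (nA); exists A.
move=> /eqP SnT; have [|m nSm mP] := @wo_powerset_min (~` S).
  by apply/set0P/eqP => E; apply: SnT; rewrite -(setCK S) E setC0.
apply: nSm; apply: sub_countable cS; apply: subset_card_le => y ym.
by apply: contrapT => /mP /(lt_le_trans ym); rewrite ltxx.
Qed.

Definition iso d d' (A : orderType d) (B : orderType d') : Prop :=
  exists f : A -> B, {mono f : x y / x <= y} /\ bijective f.

Definition embeds d d' (A : orderType d) (B : orderType d') : Prop :=
  exists f : A -> B, {homo f : x y / x <= y} /\ injective f.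

Definition surjected d d' (B : orderType d) (A : orderType d') : Prop :=
  [set: B] = set0 \/
  exists f : A -> B, {homo f : x y / x <= y} /\ (forall y, exists x, f x = y).

Definition strongly_surjective d (A : orderType d) : Prop :=
  forall B : set A, surjected (set_type B) A.

Definition no_endpoints d (A : orderType d) (I : set A) : Prop :=
  I `&` lbound I = set0 /\ I `&` ubound I = set0.

Definition aleph1_dense d (A : orderType d) : Prop :=
  [/\ [set: A] !=set0,
      no_endpoints [set: A] &
      forall a b : A, a < b -> [set x | a <= x <= b] #= [set: omega1]].

Definition countryman d (C : orderType d) : Prop :=
  ~~ countable [set: C] /\
  exists F : nat -> set (C *p C),
    (forall n p q, F n p -> F n q -> p >=< q) /\
    \bigcup_n F n = [set: C *p C].

(* 0 is not a limit: a decomposition may start with any countable set. *)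
Definition limit (x : omega1) : Prop :=
  (exists y, y < x) /\ (forall y, y < x -> exists2 z, y < z & z < x).

Definition decomposition d (A : orderType d) (D : omega1 -> set A) : Prop :=
  [/\ forall x, countable (D x),
      {homo D : x y / x <= y >-> x `<=` y},
      \bigcup_x D x = [set: A] &
      forall x, limit x -> D x = \bigcup_(y in [set y | y < x]) D y].

Definition convex d (A : orderType d) (I : set A) : Prop :=
  forall x y z, I x -> I z -> x <= y <= z -> I y.

Definition avoiding_interval d (A : orderType d) (D I : set A) : Prop :=
  [/\ I !=set0, convex I & I `&` D = set0].

Definition complementary_interval d (A : orderType d) (D I : set A) : Prop :=
  avoiding_interval D I /\
  forall J, avoiding_interval D J -> I `<=` J -> J = I.

(* The definition makes sense for an arbitrary linear order. It is meant for
   Aronszajn lines, and in particular for Countryman lines. *)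
Definition nonstationary d (A : orderType d) : Prop :=
  exists D : omega1 -> set A, decomposition D /\
    forall x I, complementary_interval (D x) I -> no_endpoints I.

Definition normal d (A : orderType d) : Prop :=
  nonstationary A /\ aleph1_dense A.

(* As usual in forcing, stronger conditions are smaller, so that dense sets are
   downward dense and filters are upward closed; antisymmetry is not required
   of the order. *)
Section Forcing.
Context d (P : preorderType d).
Implicit Types (p q r : P) (X D G : set P).

Definition compatible p q : Prop := exists2 r, r <= p & r <= q.

Definition antichain X : Prop :=
  forall p q, X p -> X q -> compatible p q -> p = q.

Definition ccc : Prop := forall X, antichain X -> countable X.

Definition forcing_dense D : Prop := forall p, exists2 q, D q & q <= p.

Definition forcing_filter G : Prop :=
  [/\ G !=set0,
      forall p q, G p -> p <= q -> G q &
      forall p q, G p -> G q -> exists2 r, G r & r <= p /\ r <= q].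

End Forcing.

Definition MA_aleph1 : Prop :=
  forall d (P : preorderType d), [set: P] !=set0 -> ccc P ->
  forall DD : set (set P), DD #<= [set: omega1] ->
    (forall D, DD D -> forcing_dense D) ->
  exists2 G : set P, forcing_filter G & forall D, DD D -> G `&` D !=set0.

(* Main.v *)
From HB Require Import structures.
Require Import Defs.
From mathcomp Require Import all_boot all_order.
From mathcomp Require Import boolp classical_sets functions cardinality.

Import Order.TTheory.
Local Open Scope classical_set_scope.
Local Open Scope order_scope.

Set Implicit Arguments.
Unset Strict Implicit.
Unset Printing Implicit Defensive.

(** The multiple of [C] by a suborder of [C] looks like [C] in every respect that
    matters, and Martin's axiom turns this likeness into an isomorphism.

    Let [X] be the lexicographic product of [A] and [C], and [Y] be [C]. Applying
    the chain decomposition of the square of [C] to both coordinates covers the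
    product of [X] and [Y], and the squares of both, by countably many chains
    ([comonotone_lexi_left], [comonotone_lexi]); and a decomposition witnessing
    that [C] is normal induces one of [X] ([filtration_lexi]). So let [D] and [E]
    be decompositions of [X] and [Y], without endpoints in their complementary
    intervals. By the Countryman property every subset has a countable cofinal
    subset and a countable set has countably many complementary intervals
    ([countable_cofinal], [countable_gaps]). Hence the stages [x] such that [D x]
    and [E x] are closed under countably many given operations form a closed
    unbounded set [K] ([closing_off], [closure_points_ex]).

    The forcing consists of the finite partial isomorphisms from [X] to [Y] which
    also preserve the relation of lying in one complementary interval of the
    stage [x], for each [x] in [K]. In the language of trees, these are finite
    partial isomorphisms of the trees of complementary intervals. Any point can
    be added to the domain or to the range, because complementary intervals have
    no endpoints, so that each of them is cut by the next stage into a countable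
    dense family of points with enough complementary intervals in between
    ([room], [clique_extend]). The generic object is then an isomorphism
    ([MA_iso]).

    The countable chain condition ([cliques_ccc]) is where the chains are needed.
    The stages of [K] being closed under the transport of cuts along a chain, two
    pairs in the same chain, with coordinates beyond such a stage, have their
    first coordinates in one complementary interval exactly when they have their
    second ones in one ([same_gap_transport]): on each chain, preserving the tree
    structure is automatic. Given uncountably many
    conditions, let [d] in [K] be a stage which reflects this family and [p] be a
    condition in it with entries beyond [d]. By reflection there is a condition [q]
    of the family, inside the stage [d], which has the same entries as [p] in that
    stage, and whose other entries share chains and complementary intervals of a
    stage [z] below [d] with entries of [p]. If [z] tells apart all the entries of
    [p] which are told apart at [d], then [p] and [q] are compatible
    ([amalgamate]). *)

(** * Countable sets *)

Lemma countableU T (A B : set T) :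
  countable A -> countable B -> countable (A `|` B).
Proof.
move=> cA cB.
have -> : (A `|` B)%classic = \bigcup_(b in [set: bool]) (if b then A else B).
  apply/seteqP; split=> x /=.
    by move=> [Ax|Bx]; [exists true|exists false].
  by move=> [[] _ ?]; [left|right].
by apply: bigcup_countable => // -[].
Qed.

Lemma countable_image T U (f : T -> U) (A : set T) :
  countable A -> countable (f @` A).
Proof. by apply: sub_countable; exact: card_image_le. Qed.

Lemma countable_subset T (A B : set T) : A `<=` B -> countable B -> countable A.
Proof. by move=> AB; apply: sub_countable; exact: subset_card_le. Qed.

Lemma countable_range T (f : nat -> T) : countable (range f).
Proof. by apply: countable_image; exact: countableP. Qed.

Lemma countable_seqs (T : eqType) (A : set T) : countable A ->
  countable [set s : seq T | forall z, z \in s -> A z].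
Proof.
move=> /countable_injP[f f_inj]; apply/countable_injP.
exists (fun s => pickle (map f s)) => s t /set_mem sA /set_mem tA.
move/(pcan_inj pickleK).
elim: s t sA tA => [|x s IH] [|y t] //= sA tA [fxy st].
congr cons.
  by apply: f_inj fxy; rewrite inE; [apply: sA|apply: tA]; exact: mem_head.
by apply: IH => // z zs; [apply: sA|apply: tA]; rewrite in_cons zs orbT.
Qed.

(** * The first uncountable ordinal *)

Lemma omega1_countable_le (x : omega1) : countable [set y | y <= x].
Proof.
apply: (@countable_subset _ _ ([set x] `|` [set y | y < x])).
  by move=> y /=; rewrite le_eqVlt => /orP[/eqP->|]; [left|right].
by apply: countableU; [exact: countable1|exact: omega1_countable_lt].
Qed.

Lemma omega1_bounded (S : set omega1) : countable S ->
  exists b, forall s, S s -> s < b.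
Proof.
move=> cS; apply: contrapT => nb.
move/negP: omega1_uncountable; apply.
apply: (@countable_subset _ _ (S `|` \bigcup_(s in S) [set y | y < s])); last first.
  by apply: countableU => //; apply: bigcup_countable => // s _;
     exact: omega1_countable_lt.
move=> b _; have [s [Ss bs]] : exists s, S s /\ b <= s.
  apply: contrapT => ns; apply: nb; exists b => s Ss.
  by rewrite ltNge; apply/negP => bs; apply: ns; exists s.
by move: bs; rewrite le_eqVlt => /orP[/eqP->|bs]; [left|right; exists s].
Qed.

Lemma omega1_bottom : exists b : omega1, forall y, b <= y.
Proof.
have [|b _ bP] := @omega1_well_founded [set: omega1]; last first.
  by exists b => y; exact: bP.
by apply: infinite_setN0 => /finite_set_countable; exact/negP/omega1_uncountable.
Qed.

Lemma omega1_above (x : omega1) : exists y, x < y.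
Proof.
by have [y yP] := omega1_bounded (countable1 x); exists y; apply: yP.
Qed.

Lemma omega1_sup (S : set omega1) : (exists b, forall s, S s -> s <= b) ->
  exists m, (forall s, S s -> s <= m) /\ forall b, b < m -> exists2 s, S s & b < s.
Proof.
move=> ub; have [m mub mP] := @omega1_well_founded [set b | forall s, S s -> s <= b] ub.
exists m; split=> // b bm; apply: contrapT => nb.
have /mP : forall s, S s -> s <= b.
  by move=> s Ss; rewrite leNgt; apply/negP => bs; apply: nb; exists s.
by rewrite leNgt bm.
Qed.

(** The supremum is either an element of [S] or a limit of such. *)
Lemma closed_max (S : set omega1) : S !=set0 ->
  (exists b, forall s, S s -> s <= b) ->
  (forall m, limit m -> (forall b, b < m -> exists s, [/\ S s, b < s & s < m]) ->
     S m) ->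
  exists2 m, S m & forall s, S s -> s <= m.
Proof.
move=> [s0 Ss0] /omega1_sup[m [mub mP]] clS; exists m => //.
apply: contrapT => nSm.
have lt_m s : S s -> s < m.
  by move=> Ss; rewrite lt_neqAle mub // andbT; apply: contra_notN nSm => /eqP<-.
have mP' b : b < m -> exists s, [/\ S s, b < s & s < m].
  by move=> /mP[s Ss bs]; exists s; split=> //; exact: lt_m.
apply: nSm; apply: clS => //; split; first by exists s0; exact: lt_m.
by move=> b /mP'[s [_ bs sm]]; exists s.
Qed.

(** Read [Phi z x] as: what is requested at the stage [z] is available at the
    stage [x]. The supremum of an increasing sequence of stages, each of which
    has what is requested up to the one before, has all that is requested
    below it. *)
Lemma closing_off (Phi : omega1 -> omega1 -> Prop) :
  (forall z, exists x, Phi z x) ->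
  (forall z x y, x <= y -> Phi z x -> Phi z y) ->
  forall a, exists e, [/\ limit e, a < e & forall z, z < e -> Phi z e].
Proof.
move=> exPhi monoPhi a; have [f fP] := choice exPhi.
have /choice[h hP] : forall x, exists y, x < y /\ forall z, z <= x -> Phi z y.
  move=> x.
  have cle := omega1_countable_le x.
  have [b bP] := omega1_bounded (countableU cle (countable_image f cle)).
  exists b; split=> [|z zx]; first by apply: bP; left; rewrite /= lexx.
  by apply: monoPhi (fP z); apply/ltW/bP; right; exists z.
pose s n := iter n.+1 h a.
have s_lt n : s n < s n.+1 by exact: (hP _).1.
have [b bP] := omega1_bounded (countable_range s).
have [e [eub eP]] : exists m, (forall t, range s t -> t <= m) /\
    forall b, b < m -> exists2 t, range s t & b < t.
  by apply: omega1_sup; exists b => t /bP/ltW.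
have s_lt_e n : s n < e by apply: lt_le_trans (s_lt n) _; apply: eub; exists n.+1.
have ae : a < e by apply: lt_trans (s_lt_e 0%N); exact: (hP _).1.
exists e; split=> //.
  by split; [exists a|move=> z /eP[_ [n _ <-] zs]; exists (s n)].
move=> z /eP[_ [n _ <-] zs]; apply: (monoPhi _ (s n.+1)); first exact/ltW.
by apply: (hP (s n)).2; exact: ltW.
Qed.

Lemma omega1_wf : well_founded (fun x y : omega1 => x < y).
Proof.
move=> x; apply: contrapT => nx.
have [m nm mP] := @omega1_well_founded [set x | ~ Acc (fun x y : omega1 => x < y) x]
  (ex_intro _ x nx).
apply: nm; constructor => y ym; apply: contrapT => /mP.
by rewrite leNgt ym.
Qed.

(** By recursion on [x], the block of [x] is a sequence of ordinals outside the
    blocks of the smaller ordinals, which cover a countable set only. *)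
Lemma omega1_blocks : exists E : omega1 -> nat -> omega1,
  forall x y m n, E x m = E y n -> x = y /\ m = n.
Proof.
have /choice[pick pickP] : forall B : set omega1, exists f : nat -> omega1,
    countable B -> injective f /\ forall n, ~ B (f n).
  move=> B; have [cB|ncB] := pselect (countable B); last first.
    by have [x _] := omega1_bottom; exists (fun=> x).
  have : infinite_set (~` B).
    move=> /finite_set_countable cnB; apply: (negP omega1_uncountable).
    by rewrite -(setUv B); exact: countableU.
  move=> /infiniteP/card_leP[f].
  exists (fun n => val (f (SigSub (mem_set I : n \in [set: nat])))) => _; split.
    move=> m n /val_inj fmn; have /(congr1 val) : SigSub (mem_set I : m \in _) =
      SigSub (mem_set I : n \in [set: nat]) by apply: inj fmn; rewrite inE.
    by [].
  by move=> n; case: (f _) => x /= /set_mem.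
pose step (x : omega1) (rec : forall y : omega1, y < x -> nat -> omega1) :=
  pick [set z | exists (y : omega1) (yx : y < x) n, z = rec y yx n].
pose E := Fix omega1_wf (fun _ => nat -> omega1) step.
have EE x : E x = pick [set z | exists2 y, y < x & exists n, z = E y n].
  rewrite {1}/E Fix_eq.
    congr pick; apply/seteqP; split=> z /=.
      by move=> [y [yx [n ->]]]; exists y => //; exists n.
    by move=> [y yx [n ->]]; exists y, yx, n.
  move=> {}x f g fg; congr pick; congr mkset; apply/funext => z; apply/propext.
  by split=> -[y [yx [n ->]]]; exists y, yx, n; rewrite fg.
have cE x : countable [set z | exists2 y, y < x & exists n, z = E y n].
  apply: (@countable_subset _ _ (\bigcup_(y in [set y | y < x]) range (E y))).
    by move=> z [y yx [n ->]]; exists y => //; exists n.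
  apply: bigcup_countable; first exact: omega1_countable_lt.
  by move=> y _; exact: countable_range.
have E_lt x y m n : x < y -> E x m <> E y n.
  move=> xy Exy; apply: ((pickP _ (cE y)).2 n); rewrite -EE.
  by exists x => //; exists m.
exists E => x y m n Exy; have [xy|xy|xy] := ltgtP x y.
- by case: (E_lt _ _ _ _ xy Exy).
- by case: (E_lt _ _ _ _ xy (esym Exy)).
split=> //; subst y; move: Exy; rewrite EE.
by have [+ _] := pickP _ (cE x); apply.
Qed.

(** Spread the points of [S x] over the block of [x]. *)
Lemma card_le_omega1 T (S : omega1 -> set T) : (forall x, countable (S x)) ->
  \bigcup_x S x = [set: T] -> ([set: T] #<= [set: omega1])%card.
Proof.
move=> cS covS; have [E E_inj] := omega1_blocks.
have /choice[r rP] : forall t, exists x, S x t.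
  by move=> t; have : [set: T] t by []; rewrite -covS => -[x _ Sx]; exists x.
have /choice[i iP] : forall x, exists f : T -> nat, {in S x &, injective f}.
  by move=> x; exact/countable_injP.
pose f t := E (r t) (i (r t) t).
have f_inj : injective f.
  move=> t u /E_inj[rtu]; rewrite -rtu; apply: iP; rewrite inE //.
  by rewrite rtu.
have : ([set: T] #<= f @` [set: T])%card.
  have := inj_card_eq (in2W f_inj : {in [set: T] &, injective f}).
  by rewrite card_eq_le => /andP[].
by move=> /card_le_trans; apply; exact: card_leT.
Qed.

(** * Comonotone functions and complementary intervals *)

(** The form in which the Countryman property is used: the level sets of [c] are
    countably many chains covering [X * Y]. *)
Definition comonotone dX dY (X : orderType dX) (Y : orderType dY)
    (c : X -> Y -> nat) : Prop :=
  forall x x' y y', c x y = c x' y' -> x < x' -> y <= y'.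

Lemma comonotone_flip dX dY (X : orderType dX) (Y : orderType dY)
    (c : X -> Y -> nat) : comonotone c -> comonotone (fun y x => c x y).
Proof.
move=> cc y y' x x' e yy'; rewrite leNgt; apply/negP => /(cc _ _ _ _ (esym e)).
by rewrite leNgt yy'.
Qed.

Lemma comonotone_dual dX (X : orderType dX) (c : X -> X -> nat) :
  comonotone c -> @comonotone _ _ X^d X^d c.
Proof. by move=> cc x x' y y' e /(cc _ _ _ _ (esym e)). Qed.

(** Were [L] without countable cofinal subset, every section of [c] would be
    cofinal in [L] at one of its levels; two sections have no such level in
    common, so that [L] would be countable after all. *)
Lemma countable_cofinal dX (X : orderType dX) (c : X -> X -> nat) (L : set X) :
  comonotone c ->
  exists Q : set X,
    [/\ countable Q, Q `<=` L & forall x, L x -> exists2 q, Q q & x <= q].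
Proof.
move=> cc; apply: contrapT => nQ.
have level u : exists n, forall v, L v -> exists w, [/\ L w, v <= w & c u w = n].
  apply: contrapT => nn.
  have /choice[v vP] : forall n, exists v,
      L v /\ forall w, L w -> v <= w -> c u w <> n.
    move=> n; apply: contrapT => nv; apply: nn; exists n => v Lv.
    apply: contrapT => nw; apply: nv; exists v; split=> // w Lw vw cw.
    by apply: nw; exists w.
  apply: nQ; exists (range v); split; first exact: countable_range.
    by move=> _ [n _ <-]; exact: (vP n).1.
  move=> x Lx; exists (v (c u x)) => //; rewrite leNgt; apply/negP => /ltW vx.
  exact: (vP (c u x)).2 vx _.
have [n nP] := choice level.
apply: (nQ); exists L; split=> //; last by move=> x Lx; exists x.
have n_lt u u' : L u -> L u' -> u < u' -> n u <> n u'.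
  move=> Lu Lu' uu' nuu'; have [w [Lw _ cw]] := nP u' u' Lu'.
  apply: nQ; exists [set w]; split; [exact: countable1|by move=> _ ->|].
  move=> x Lx; exists w => //; have [w1 [_ xw1 cw1]] := nP u x Lx.
  by apply: le_trans xw1 _; apply: cc uu'; rewrite cw1 cw.
apply/countable_injP; exists n => u u' /set_mem Lu /set_mem Lu' nuu'.
by have [uu'|uu'|//] := ltgtP u u'; [case: (n_lt u u')|case: (n_lt u' u)].
Qed.

Lemma countable_coinitial dX (X : orderType dX) (c : X -> X -> nat) (L : set X) :
  comonotone c ->
  exists Q : set X,
    [/\ countable Q, Q `<=` L & forall x, L x -> exists2 q, Q q & q <= x].
Proof.
by move=> cc; exact: (@countable_cofinal _ (X^d) c L (comonotone_dual cc)).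
Qed.

(** [same_gap D x y]: the points [x] and [y] lie in the same complementary
    interval of [D]; in particular they are not in [D]. *)
Definition same_gap dX (X : orderType dX) (D : set X) (x y : X) : Prop :=
  forall u, x <= u <= y \/ y <= u <= x -> ~ D u.

Section SameGap.
Context dX (X : orderType dX).
Implicit Types (D : set X) (x y z : X).

Lemma same_gap_sym D x y : same_gap D x y -> same_gap D y x.
Proof. by move=> xy u [?|?]; apply: xy; [right|left]. Qed.

Lemma same_gap_refl D x : ~ D x -> same_gap D x x.
Proof. by move=> Dx u [] /le_anti <-. Qed.

Lemma same_gap_notin D x y : same_gap D x y -> ~ D x.
Proof.
by move=> xy; apply: xy; have [?|/ltW ?] := leP x y; [left|right]; rewrite lexx ?andbT.
Qed.

Lemma same_gap_trans D y x z : same_gap D x y -> same_gap D y z -> same_gap D x z.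
Proof.
move=> xy yz u [/andP[xu uz]|/andP[zu ux]]; have [uy|/ltW yu] := leP u y.
- by apply: xy; left; rewrite xu.
- by apply: yz; left; rewrite yu.
- by apply: yz; right; rewrite zu.
- by apply: xy; right; rewrite yu.
Qed.

Lemma same_gap_sub D D' x y : D `<=` D' -> same_gap D' x y -> same_gap D x y.
Proof. by move=> DD' xy u /xy D'u /DD'. Qed.

Lemma same_gap_between D x y z : x <= y -> y <= z -> same_gap D x z ->
  same_gap D x y /\ same_gap D y z.
Proof.
move=> xy yz xz; have xz' := le_trans xy yz.
split=> u [/andP[a b]|/andP[a b]]; apply: xz; left; apply/andP; split => //.
- exact: le_trans b yz.
- exact: le_trans xy a.
- exact: le_trans b xz'.
- exact: le_trans xy a.
- exact: le_trans xz' a.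
- exact: le_trans b yz.
Qed.

(** Complementary intervals are convex, so a point outside one of them
    compares in the same way with all its elements. *)
Lemma same_gap_lt D x y z : same_gap D x y -> ~ same_gap D x z ->
  ((x < z) = (y < z)) * ((z < x) = (z < y)).
Proof.
move=> xy xz.
have aux u v : same_gap D u v -> ~ same_gap D u z -> u < z -> v < z.
  move=> uv uz ltuz; rewrite ltNge; apply/negP => zv.
  by have [] := same_gap_between (ltW ltuz) zv uv.
have aux' u v : same_gap D u v -> ~ same_gap D u z -> z < u -> z < v.
  move=> uv uz ltzu; rewrite ltNge; apply/negP => vz.
  have [_ /same_gap_sym] := same_gap_between vz (ltW ltzu) (same_gap_sym uv).
  exact: uz.
have yx := same_gap_sym xy.
have yz : ~ same_gap D y z by move=> /(same_gap_trans xy).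
by split; apply/idP/idP; [apply: aux|apply: aux|apply: aux'|apply: aux'].
Qed.

Lemma not_same_gap D x y : ~ same_gap D x y -> x <= y ->
  exists u, [/\ x <= u, u <= y & D u].
Proof.
move=> nxy xy; apply: contrapT => nu; apply: nxy => u [/andP[? ?] Du|/andP[yu ux] Du].
  by apply: nu; exists u.
by apply: nu; exists u; rewrite (le_trans xy yu) (le_trans ux xy).
Qed.

(** Pick a point in every complementary interval. If [c u] is injective on the
    picked points for some picked [u], they are countable; otherwise every
    picked [u] has two of them on the same level [n], with an element [d] of [D]
    in between, and the pair [(n, d)] determines [u]. *)
Lemma countable_gaps (c : X -> X -> nat) D : comonotone c -> countable D ->
  exists2 G : set X, countable G & forall x, ~ D x -> exists2 g, G g & same_gap D x g.
Proof.
move=> cc cD.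
pose r x := choose (fun g => `[< same_gap D x g >]) x.
have rP x : ~ D x -> same_gap D x (r x).
  move=> /same_gap_refl xx; apply/asboolP.
  by apply: (@chooseP _ (fun g => `[< same_gap D x g >]) x); exact/asboolP.
have r_eq x y : ~ D x -> same_gap D x y -> r x = r y.
  move=> Dx xy; rewrite /r.
  have -> : (fun g => `[< same_gap D y g >]) = (fun g => `[< same_gap D x g >]).
    apply/funext => g; apply/asbool_equiv_eq; split; apply: same_gap_trans => //.
    exact: same_gap_sym.
  by apply: choose_id; apply/asboolP => //; exact: same_gap_refl.
pose U := r @` [set x | ~ D x].
exists U; last by move=> x Dx; exists (r x); [exists x|exact: rP].
have U_notin u : U u -> ~ D u.
  by move=> [x Dx <-]; exact: same_gap_notin (same_gap_sym (rP _ Dx)).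
have U_sep u v : U u -> U v -> u < v -> exists d, [/\ u < d, d < v & D d].
  move=> Uu Uv uv; have [|d [ud dv Dd]] := @not_same_gap D u v _ (ltW uv).
    move: Uu Uv uv => [x Dx <-] [y Dy <-] + xy; have {}xy : same_gap D x y.
      apply: same_gap_trans (rP _ Dx) _; apply: same_gap_trans xy _.
      exact/same_gap_sym/rP.
    by rewrite (r_eq _ _ Dx xy) ltxx.
  exists d; split=> //; rewrite lt_neqAle ?ud ?dv andbT; apply/eqP => e.
    by apply: U_notin Uu _; rewrite e.
  by apply: U_notin Uv _; rewrite -e.
have [[u Uu inj_u]|ninj] := pselect (exists2 u, U u & {in U &, injective (c u)}).
  by apply/countable_injP; exists (c u).
have /choice[s sP] : forall u, exists nd : nat * X, U u ->
    exists v v', [/\ U v, U v', c u v = nd.1, c u v' = nd.1 & v < nd.2 < v' /\ D nd.2].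
  move=> u; have [Uu|nUu] := pselect (U u); last by exists (0%N, u).
  apply: contrapT => nnd; apply: ninj; exists u => //.
  move=> v v' /set_mem Uv /set_mem Uv' cvv'.
  have [vv'|vv'|//] := ltgtP v v'.
    have [d [vd dv Dd]] := U_sep _ _ Uv Uv' vv'; case: nnd; exists (c u v, d) => _.
    by exists v, v'; split; rewrite //= vd dv.
  have [d [vd dv Dd]] := U_sep _ _ Uv' Uv vv'; case: nnd; exists (c u v, d) => _.
  by exists v', v; split; rewrite //= vd dv.
have s_lt u u' : U u -> U u' -> u < u' -> s u <> s u'.
  move=> Uu Uu' uu' suu'.
  have [v [v' [_ _ _ cv' [/andP[_ dv'] _]]]] := sP _ Uu.
  have [w [w' [_ _ cw _ [/andP[wd _] _]]]] := sP _ Uu'.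
  have /(cc _ _ _ _) : c u v' = c u' w by rewrite cv' cw suu'.
  by move=> /(_ uu'); rewrite leNgt -suu' in wd *; rewrite (lt_trans wd dv').
have cS : countable (s @` U).
  apply: (@countable_subset _ _ ([set: nat] `*` D)).
    by move=> _ [u /sP[v [v' [_ _ _ _ [_ Du]]]] <-].
  by apply: countableX => //; exact: countableP.
have s_inj : {in U &, injective s}.
  move=> u u' /set_mem Uu /set_mem Uu' suu'.
  by have [uu'|uu'|//] := ltgtP u u'; [case: (s_lt u u')|case: (s_lt u' u)].
by rewrite -(eq_countable (inj_card_eq s_inj)).
Qed.

End SameGap.

(** * Filtrations and their closure points *)

(** A decomposition which starts from the empty set and none of whose
    complementary intervals has an endpoint. As the first stage is empty, any two
    points share a complementary interval at some stage. *)
Record filtration dX (X : orderType dX) (D : omega1 -> set X) : Prop := Filtration {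
  filtration_countable : forall x, countable (D x);
  filtration_mono : forall x y, x <= y -> D x `<=` D y;
  filtration_cover : forall t, exists x, D x t;
  filtration_limit : forall x t, limit x -> D x t -> exists2 y, y < x & D y t;
  filtration_bottom : forall x t, (forall y, x <= y) -> ~ D x t;
  filtration_above : forall x t, ~ D x t -> exists2 u, t < u & same_gap (D x) t u;
  filtration_below : forall x t, ~ D x t -> exists2 u, u < t & same_gap (D x) t u
}.

Lemma filtration_gap dX (X : orderType dX) (D : omega1 -> set X) x x' u v :
  filtration D -> x' <= x -> same_gap (D x) u v -> same_gap (D x') u v.
Proof. by move=> fD /(filtration_mono fD); exact: same_gap_sub. Qed.

Lemma filtration_absorb dX (X : orderType dX) (D : omega1 -> set X) (Q : set X) :
  filtration D -> countable Q -> exists x, Q `<=` D x.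
Proof.
move=> fD cQ; have /choice[r rP] := filtration_cover fD.
have [b bP] := omega1_bounded (countable_image r cQ).
exists b => q Qq; apply: (filtration_mono fD) (rP q); apply/ltW/bP.
by exists q.
Qed.

(** What a closure point above [z] must contain for [D]: points cofinal and
    coinitial in each complementary interval of [D z], points converging from
    both sides to each point of [D z], and bounds which make [c] transport cuts
    at points of [D z] to cuts at points of [E]. *)
Definition fulfilled dX dY (X : orderType dX) (Y : orderType dY)
    (c : X -> Y -> nat) (D : omega1 -> set X) (E : omega1 -> set Y)
    (z x : omega1) : Prop :=
  [/\ forall t, ~ D z t -> exists q, [/\ D x q, same_gap (D z) t q & t < q],
      forall t, ~ D z t -> exists q, [/\ D x q, same_gap (D z) t q & q < t],
      forall e u, D z e -> e < u -> exists q, [/\ D x q, e < q & q <= u],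
      forall e u, D z e -> u < e -> exists q, [/\ D x q, u <= q & q < e] &
      forall e t y, D z e -> t < e ->
        exists q t', [/\ E x q, y <= q, t' < e & c t' q = c t y]].

Section Fulfilled.
Context dX dY (X : orderType dX) (Y : orderType dY).
Variables (c : X -> Y -> nat) (cX : X -> X -> nat) (cY : Y -> Y -> nat).
Hypotheses (cXP : comonotone cX) (cYP : comonotone cY).
Variables (D : omega1 -> set X) (E : omega1 -> set Y).
Hypotheses (fD : filtration D) (fE : filtration E).

Lemma fulfilled_mono z x y : x <= y -> fulfilled c D E z x -> fulfilled c D E z y.
Proof.
move=> xy [h1 h2 h3 h4 h5]; have Dxy := filtration_mono fD xy.
have Exy := filtration_mono fE xy; split.
- by move=> t /h1[q [/Dxy]]; exists q.
- by move=> t /h2[q [/Dxy]]; exists q.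
- by move=> e u De /(h3 _ _ De)[q [/Dxy]]; exists q.
- by move=> e u De /(h4 _ _ De)[q [/Dxy]]; exists q.
- by move=> e t v De te; have [q [t' [/Exy]]] := h5 e t v De te; exists q, t'.
Qed.

Lemma fulfilled_ex z : exists x, fulfilled c D E z x.
Proof.
have cD := filtration_countable fD z.
have [G cG GP] := countable_gaps cXP cD.
have /choice[up upP] := fun L => countable_cofinal L cXP.
have /choice[dn dnP] := fun L => countable_coinitial L cXP.
have /choice[upY upYP] := fun L => countable_cofinal L cYP.
have cup L : countable (up L) by case: (upP L).
have cdn L : countable (dn L) by case: (dnP L).
pose Q1 := \bigcup_(g in G) (up [set t | same_gap (D z) g t] `|`
  dn [set t | same_gap (D z) g t])%classic.
pose Q2 := \bigcup_(e in D z) (up [set t | t < e] `|` dn [set t | e < t])%classic.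
pose Q3 := \bigcup_(en in D z `*` [set: nat])
  upY [set y | exists2 t, t < en.1 & c t y = en.2].
have [x1 Qx1] : exists x, (Q1 `|` Q2)%classic `<=` D x.
  apply: (filtration_absorb fD); apply: countableU; apply: bigcup_countable => // t _;
    by apply: countableU; [exact: cup|exact: cdn].
have [x2 Qx2] : exists x, Q3 `<=` E x.
  apply: (filtration_absorb fE); apply: bigcup_countable.
    by apply: countableX => //; exact: countableP.
  by move=> en _; case: (upYP [set y | exists2 t, t < en.1 & c t y = en.2]).
exists (Order.max x1 x2).
have {}Qx1 : (Q1 `|` Q2)%classic `<=` D (Order.max x1 x2).
  by apply: subset_trans Qx1 _; apply: (filtration_mono fD); rewrite le_max lexx.
have {}Qx2 : Q3 `<=` E (Order.max x1 x2).
  by apply: subset_trans Qx2 _; apply: (filtration_mono fE); rewrite le_max lexx orbT.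
split.
- move=> t Dt; have [t' tt' tt'_gap] := filtration_above fD Dt.
  have [g Gg tg] := GP _ Dt.
  have [_ sub cof] := upP [set u | same_gap (D z) g u].
  have [|q uq t'q] := cof t'; first exact: same_gap_trans (same_gap_sym tg) tt'_gap.
  exists q; split; [|exact: same_gap_trans tg (sub _ uq)|exact: lt_le_trans t'q].
  by apply: Qx1; left; exists g => //; left.
- move=> t Dt; have [t' tt' tt'_gap] := filtration_below fD Dt.
  have [g Gg tg] := GP _ Dt.
  have [_ sub cof] := dnP [set u | same_gap (D z) g u].
  have [|q uq t'q] := cof t'; first exact: same_gap_trans (same_gap_sym tg) tt'_gap.
  exists q; split; [|exact: same_gap_trans tg (sub _ uq)|exact: le_lt_trans tt'].
  by apply: Qx1; left; exists g => //; right.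
- move=> e u De eu; have [_ sub cof] := dnP [set t | e < t].
  have [q dq qu] := cof _ eu; exists q; split=> //; last exact: sub.
  by apply: Qx1; right; exists e => //; right.
- move=> e u De ue; have [_ sub cof] := upP [set t | t < e].
  have [q uq qu] := cof _ ue; exists q; split=> //; last exact: sub.
  by apply: Qx1; right; exists e => //; left.
- move=> e t y De te.
  have [_ sub cof] := upYP [set v | exists2 s, s < e & c s v = c t y].
  have [|q uq yq] := cof y; first by exists t.
  have [t' t'e ct'] := sub _ uq; exists q, t'; split=> //.
  by apply: Qx2; exists (e, c t y).
Qed.

End Fulfilled.

(** The stages which contain what is requested below them in both directions,
    and the first stage. All but the first are limits, so a point of [D x] is
    already in an earlier stage, whose requests [D x] fulfils. *)
Record closure_points dX dY (X : orderType dX) (Y : orderType dY)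
    (c : X -> Y -> nat) (D : omega1 -> set X) (E : omega1 -> set Y)
    (K : set omega1) : Prop := ClosurePoints {
  cp_closed : forall m, limit m ->
    (forall b, b < m -> exists x, [/\ K x, b < x & x < m]) -> K m;
  cp_unbounded : forall a, exists2 x, K x & a < x;
  cp_bottom : exists2 x, K x & forall y, x <= y;
  cp_limit : forall x z, K x -> z < x -> limit x;
  cp_left : forall x z, K x -> z < x -> fulfilled c D E z x;
  cp_right : forall x z, K x -> z < x -> fulfilled (fun y t => c t y) E D z x
}.

Lemma closure_points_flip dX dY (X : orderType dX) (Y : orderType dY)
    (c : X -> Y -> nat) (D : omega1 -> set X) (E : omega1 -> set Y)
    (K : set omega1) :
  closure_points c D E K -> closure_points (fun y t => c t y) E D K.
Proof. by case=> *; split. Qed.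

Lemma closure_points_ex dX dY (X : orderType dX) (Y : orderType dY)
    (c : X -> Y -> nat) (cX : X -> X -> nat) (cY : Y -> Y -> nat)
    (D : omega1 -> set X) (E : omega1 -> set Y) :
  comonotone cX -> comonotone cY -> filtration D -> filtration E ->
  exists K, closure_points c D E K.
Proof.
move=> cXP cYP fD fE.
pose Phi z x := fulfilled c D E z x /\ fulfilled (fun y t => c t y) E D z x.
have Phi_mono z x y : x <= y -> Phi z x -> Phi z y.
  by move=> xy [/(fulfilled_mono fD fE xy) ? /(fulfilled_mono fE fD xy)].
have Phi_ex z : exists x, Phi z x.
  have [x zx] := fulfilled_ex c cXP cYP fD fE z.
  have [y zy] := fulfilled_ex (fun y t => c t y) cYP cXP fE fD z.
  exists (Order.max x y); split.
    by apply: (fulfilled_mono fD fE) zx; rewrite le_max lexx.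
  by apply: (fulfilled_mono fE fD) zy; rewrite le_max lexx orbT.
exists [set x | (limit x \/ forall y, x <= y) /\ forall z, z < x -> Phi z x]; split.
- move=> m lm Km; split=> [|z zm]; first by left.
  have [x [[_ Phix] zx xm]] := Km _ zm.
  by apply: Phi_mono (ltW xm) _; exact: Phix.
- move=> a; have [e [le ae Phie]] := closing_off Phi_ex Phi_mono a.
  by exists e => //; split=> //; left.
- have [m mP] := omega1_bottom; exists m => //.
  split; first by right.
  by move=> z; rewrite ltNge mP.
- by move=> x z [[//|xb] _]; rewrite ltNge xb.
- by move=> x z [_ Phix] /Phix[].
- by move=> x z [_ Phix] /Phix[].
Qed.

Lemma cp_next dX dY (X : orderType dX) (Y : orderType dY)
    (c : X -> Y -> nat) (D : omega1 -> set X) (E : omega1 -> set Y)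
    (K : set omega1) : closure_points c D E K ->
  forall a, exists x, [/\ K x, a < x & forall y, K y -> a < y -> x <= y].
Proof.
move=> cp a; have [x Kx ax] := cp_unbounded cp a.
have [|m [Km am] mP] := @omega1_well_founded [set x | K x /\ a < x]; first by exists x.
by exists m; split=> // y Ky ay; apply: mP.
Qed.

(** * Finite approximations of an isomorphism *)

Section Linked.
Context dX dY (X : orderType dX) (Y : orderType dY).
Variables (D : omega1 -> set X) (E : omega1 -> set Y) (K : set omega1).

(** This has content also for [p = q]: as [same_gap (D x) t t] means that [t] is
    not in [D x], an entry linked with itself has coordinates which appear at the
    same stage of [K]. *)
Definition linked (p q : X * Y) : Prop :=
  [/\ (p.1 < q.1) = (p.2 < q.2), (q.1 < p.1) = (q.2 < p.2) &
      forall x, K x -> same_gap (D x) p.1 q.1 <-> same_gap (E x) p.2 q.2].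

Definition clique (s : seq (X * Y)) : Prop :=
  forall p q, p \in s -> q \in s -> linked p q.

Lemma linked_sym p q : linked p q -> linked q p.
Proof.
move=> [h1 h2 h3]; split=> // x Kx.
by split=> /same_gap_sym/(h3 _ Kx)/same_gap_sym.
Qed.

Lemma linked_notin x p : K x -> linked p p -> D x p.1 <-> E x p.2.
Proof.
move=> Kx [_ _ /(_ _ Kx) h]; split=> ?; apply: contrapT => /same_gap_refl/h.
  by move=> /same_gap_notin.
by move=> /same_gap_notin.
Qed.

Lemma clique_nil : clique [::].
Proof. by []. Qed.

Lemma clique_cons p s : linked p p -> (forall q, q \in s -> linked p q) ->
  clique s -> clique (p :: s).
Proof.
move=> pp ps cs q r; rewrite !inE => /orP[/eqP->|qs] /orP[/eqP->|rs] //.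
- exact: ps.
- exact/linked_sym/ps.
- exact: cs.
Qed.

End Linked.

Lemma clique_flip dX dY (X : orderType dX) (Y : orderType dY)
    (D : omega1 -> set X) (E : omega1 -> set Y) (K : set omega1) (s : seq (X * Y)) :
  clique D E K s -> clique E D K [seq (p.2, p.1) | p <- s].
Proof.
move=> cs _ _ /mapP[p ps ->] /mapP[q qs ->]; have [h1 h2 h3] := cs _ _ ps qs.
by split=> // x Kx; split=> /(h3 _ Kx).
Qed.

Lemma seq_maximum (T : eqType) (R : T -> T -> Prop) (s : seq T) (t0 : T) :
  (forall t u, R t u \/ R u t) -> (forall t u v, R t u -> R u v -> R t v) ->
  t0 \in s -> exists2 m, m \in s & forall t, t \in s -> R t m.
Proof.
move=> Rtot Rtr; have Rxx t : R t t by case: (Rtot t t).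
elim: s t0 => // t s IH t0 _; case: s IH => [|u s] IH.
  by exists t; rewrite ?mem_head // => v; rewrite inE => /eqP->.
have [|m ms mP] := IH u; first exact: mem_head.
have [tm|mt] := Rtot t m.
  exists m; first by rewrite in_cons ms orbT.
  by move=> v; rewrite in_cons => /orP[/eqP->|/mP].
exists t; first exact: mem_head.
by move=> v; rewrite in_cons => /orP[/eqP->|/mP vm] //; exact: Rtr mt.
Qed.

Section Transport.
Context dX dY (X : orderType dX) (Y : orderType dY).
Variables (c : X -> Y -> nat) (D : omega1 -> set X) (E : omega1 -> set Y).
Variable (K : set omega1).
Hypotheses (cP : comonotone c) (fD : filtration D) (cp : closure_points c D E K).

Lemma cp_stage x t : K x -> D x t -> exists2 z, z < x & D z t.
Proof.
move=> Kx Dxt; apply: (filtration_limit fD) => //.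
have [[z zx]|nz] := pselect (exists z, z < x); first exact: cp_limit cp _ _ Kx zx.
case: (filtration_bottom fD _ Dxt) => y; rewrite leNgt; apply/negP => yx.
by apply: nz; exists y.
Qed.

(** The chains covering [X * Y] respect complementary intervals: a point of
    [D x] between [t] and [t'] is transported by [c] to one of [E x] between
    [y] and [y']. *)
Lemma same_gap_transport x t t' y y' : K x -> c t y = c t' y' ->
  ~ D x t -> ~ D x t' -> same_gap (E x) y y' -> same_gap (D x) t t'.
Proof.
move=> Kx; wlog tt' : t t' y y' / t <= t'.
  move=> H; have [tt'|/ltW t't] := leP t t'; first exact: H.
  by move=> e Dt Dt' /same_gap_sym yy'; apply: same_gap_sym; exact: H (esym e) _ _ yy'.
move=> e Dt Dt' yy'; apply: contrapT => /not_same_gap/(_ tt')[u [tu ut' Du]].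
have {}tu : t < u by rewrite lt_neqAle tu andbT; apply: contra_notN Dt => /eqP->.
have {}ut' : u < t' by rewrite lt_neqAle ut' andbT; apply: contra_notN Dt' => /eqP<-.
have [z zx Dzu] := cp_stage Kx Du.
have [_ _ _ _ /(_ _ _ y Dzu tu)[q [t1 [Eq yq t1u ct1]]]] := cp_left cp Kx zx.
apply: yy' Eq; left; rewrite yq /=.
by apply: cP (lt_trans t1u ut'); rewrite ct1.
Qed.

Lemma cp_dense_right x e u : K x -> D x e -> e < u ->
  exists q, [/\ D x q, e < q & q <= u].
Proof.
move=> Kx /(cp_stage Kx)[z zx Dze] eu.
by have [_ _ h _ _] := cp_left cp Kx zx; exact: h Dze eu.
Qed.

Lemma cp_dense_left x e u : K x -> D x e -> u < e ->
  exists q, [/\ D x q, u <= q & q < e].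
Proof.
move=> Kx /(cp_stage Kx)[z zx Dze] eu.
by have [_ _ _ h _] := cp_left cp Kx zx; exact: h Dze eu.
Qed.

Hypothesis uncountable_itv : forall a b : X, a < b -> ~ countable [set t | a < t < b].

Lemma itv_mid (a b : X) : a < b -> exists2 t, a < t & t < b.
Proof.
move=> ab; apply: contrapT => nt; apply: (uncountable_itv ab).
have -> : [set t | a < t < b] = set0; last exact: countable0.
by rewrite -subset0 => t /andP[ta tb]; apply: nt; exists t.
Qed.

(** [lo] and [hi] are the values already taken to the left and to the right of a
    new argument, in a complementary interval of [D z]; a new value is sought
    between [e1] and [e2], which [D x] separates from the old ones. If there are
    old values on one side only, such points exist because [D x] is cofinal and
    coinitial in the interval. If [m] and [n] are the nearest old values, some
    point of [D x] lies between them, and points of [D x] converge to it from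
    both sides. *)
Lemma room z x (u0 : X) (lo hi : seq X) : K x -> z < x -> ~ D z u0 ->
  (forall l, l \in lo -> same_gap (D z) u0 l) ->
  (forall h, h \in hi -> same_gap (D z) u0 h) ->
  (forall l h, l \in lo -> h \in hi -> l < h /\ ~ same_gap (D x) l h) ->
  exists e1 e2, [/\ e1 < e2, D x e1 /\ D x e2,
    same_gap (D z) u0 e1 /\ same_gap (D z) u0 e2,
    forall l, l \in lo -> l < e1 & forall h, h \in hi -> e2 < h].
Proof.
move=> Kx zx Du0 lo_gap hi_gap lohi.
have [up dn _ _ _] := cp_left cp Kx zx.
have up2 m : same_gap (D z) u0 m -> (forall l, l \in lo -> l <= m) -> hi = [::] ->
    exists e1 e2, [/\ e1 < e2, D x e1 /\ D x e2,
    same_gap (D z) u0 e1 /\ same_gap (D z) u0 e2,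
    forall l, l \in lo -> l < e1 & forall h, h \in hi -> e2 < h].
  move=> u0m lom ->.
  have [e1 [De1 me1 lt1]] := up m (same_gap_notin (same_gap_sym u0m)).
  have [e2 [De2 e12 lt2]] := up e1 (same_gap_notin (same_gap_sym me1)).
  have u0e1 := same_gap_trans u0m me1; exists e1, e2; split=> //.
    by split=> //; exact: same_gap_trans e12.
  by move=> l /lom ll; exact: le_lt_trans ll lt1.
have ltot (a b : X) : a <= b \/ b <= a by apply/orP/le_total.
have gtot (a b : X) : b <= a \/ a <= b by apply/orP/le_total.
have [lo0|[l0 l0lo]] : lo = [::] \/ exists l, l \in lo.
  by case: lo {lo_gap lohi up2} => [|l lo]; [left|right; exists l; exact: mem_head].
all: have [hi0|[h0 h0hi]] : hi = [::] \/ exists h, h \in hi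
  by case: hi {hi_gap lohi up2} => [|h hi]; [left|right; exists h; exact: mem_head].
- by apply: (up2 u0) => //; [exact: same_gap_refl|rewrite lo0].
- have [|m mhi mP] := @seq_maximum _ (fun a b : X => b <= a) hi h0 gtot _ h0hi.
    by move=> a b d ab bd; exact: le_trans bd ab.
  have u0m := hi_gap _ mhi.
  have [e2 [De2 me2 lt2]] := dn m (same_gap_notin (same_gap_sym u0m)).
  have [e1 [De1 e21 lt1]] := dn e2 (same_gap_notin (same_gap_sym me2)).
  have u0e2 := same_gap_trans u0m me2; exists e1, e2; split=> //.
  + by split=> //; exact: same_gap_trans e21.
  + by rewrite lo0.
  + by move=> h /mP; exact: lt_le_trans.
- have [|m mlo mP] := @seq_maximum _ (fun a b : X => a <= b) lo l0 ltot _ l0lo.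
    by move=> a b d; exact: le_trans.
  by apply: (up2 m) => //; exact: lo_gap.
have [|m mlo mP] := @seq_maximum _ (fun a b : X => a <= b) lo l0 ltot _ l0lo.
  by move=> a b d; exact: le_trans.
have [|n nhi nP] := @seq_maximum _ (fun a b : X => b <= a) hi h0 gtot _ h0hi.
  by move=> a b d ab bd; exact: le_trans bd ab.
have [mn mn_gap] := lohi _ _ mlo nhi.
have [e1 [e2 [e12 De1 De2 me1 e2n]]] : exists e1 e2,
    [/\ e1 < e2, D x e1, D x e2, m < e1 & e2 < n].
  have [e [me en De]] := not_same_gap mn_gap (ltW mn).
  move: en; rewrite le_eqVlt => /orP[/eqP en|en].
    subst e; have [v mv vn] := itv_mid mn.
    have [e2 [De2 ve2 e2n]] := cp_dense_left Kx De vn.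
    have [w vw we2] : exists2 w, m < w & w < e2.
      by apply: itv_mid; exact: lt_le_trans ve2.
    have [e1 [De1 we1 e12]] := cp_dense_left Kx De2 we2.
    by exists e1, e2; split=> //; exact: lt_le_trans we1.
  have [v ev vn] := itv_mid en.
  have [e2 [De2 ee2 e2v]] := cp_dense_right Kx De ev.
  have [w ew we2] := itv_mid ee2.
  have [e1 [De1 ee1 e1w]] := cp_dense_right Kx De ew.
  exists e1, e2; split=> //; [exact: le_lt_trans we2|exact: le_lt_trans ee1|].
  exact: le_lt_trans vn.
have m_n : same_gap (D z) m n.
  by apply: same_gap_trans (hi_gap _ nhi); exact/same_gap_sym/lo_gap.
exists e1, e2; split=> //.
- have me2 := lt_trans me1 e12; have e1n := lt_trans e12 e2n.
  have [? _] := same_gap_between (ltW me1) (ltW e1n) m_n.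
  have [? _] := same_gap_between (ltW me2) (ltW e2n) m_n.
  by split; apply: same_gap_trans (lo_gap _ mlo) _.
- by move=> l /mP lm; exact: le_lt_trans me1.
- by move=> h /nP; exact: lt_le_trans.
Qed.

(** This closure point is the height of [t] in the tree of complementary
    intervals: [t] appears at the next one. *)
Lemma last_omitting t : exists l, [/\ K l, ~ D l t &
  forall x, K x -> ~ D x t -> x <= l].
Proof.
have [l [Kl Dl] lP] : exists2 l, K l /\ ~ D l t & forall x, K x /\ ~ D x t -> x <= l.
  apply: (@closed_max [set x | K x /\ ~ D x t]).
  - have [b Kb bP] := cp_bottom cp; exists b; split=> //.
    exact: filtration_bottom fD _ _ bP.
  - have [b Db] := filtration_cover fD t; exists b => x [_ Dx].
    by rewrite leNgt; apply: contra_notN Dx => /ltW/(filtration_mono fD); exact.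
  - move=> m lm Km; split.
      by apply: (cp_closed cp) lm _ => b /Km[x [[Kx _] bx xm]]; exists x.
    move=> /(filtration_limit fD lm)[b /Km[x [[_ Dx] bx _]] Db].
    by apply: Dx; exact: filtration_mono fD _ _ (ltW bx) _ Db.
by exists l; split=> // x Kx Dx; apply: lP.
Qed.

End Transport.

Section Extension.
Context dX dY (X : orderType dX) (Y : orderType dY).
Variables (c : X -> Y -> nat) (D : omega1 -> set X) (E : omega1 -> set Y).
Variable (K : set omega1).
Hypotheses (fD : filtration D) (fE : filtration E).
Hypotheses (cp : closure_points c D E K).
Hypothesis uncountable_itv : forall a b : Y, a < b -> ~ countable [set t | a < t < b].
Variable y1 : Y.

(** The place of [t] relative to [s] is read off from an entry of [s] whose
    first coordinate shares the complementary interval of [t] for as long as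
    possible; [z] is the last stage where it does and [y0] its second
    coordinate. *)
Lemma nearest_entry s t : clique D E K s -> exists z y0,
  [/\ K z, ~ D z t, ~ E z y0 &
  [/\ forall p x, p \in s -> K x -> x <= z ->
        same_gap (D x) t p.1 <-> same_gap (E x) y0 p.2,
      forall p x, p \in s -> K x -> z < x -> ~ same_gap (D x) t p.1 &
      forall p, p \in s -> ~ same_gap (D z) t p.1 ->
        (t < p.1) = (y0 < p.2) /\ (p.1 < t) = (p.2 < y0)]].
Proof.
move=> cs; have [b Kb bP] := cp_bottom cp.
have Db u : ~ D b u by exact: filtration_bottom fD _ _ bP.
have Eb u : ~ E b u by exact: filtration_bottom fE _ _ bP.
have Db_gap u v : same_gap (D b) u v by move=> w _; exact: Db.
case: s cs => [|q s] cs; first by exists b, y1; split.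
pose R (p p' : X * Y) := forall x, K x -> same_gap (D x) t p.1 -> same_gap (D x) t p'.1.
have [||p0 p0s p0P] := @seq_maximum _ R (q :: s) q _ _ (mem_head _ _).
- move=> p p'; have [|nR] := pselect (R p p'); [by left|right=> x Kx tp'].
  apply: contrapT => tp; apply: nR => x' Kx' tp2.
  apply: (filtration_gap fD) tp'; rewrite leNgt; apply/negP => /ltW xx'.
  by apply: tp; exact: filtration_gap fD _ tp2.
- by move=> p p' p'' h h' x Kx /(h _ Kx)/(h' _ Kx).
have [z [Kz tz] zP] : exists2 z, K z /\ same_gap (D z) t p0.1 &
    forall x, K x /\ same_gap (D x) t p0.1 -> x <= z.
  apply: (@closed_max [set x | K x /\ same_gap (D x) t p0.1]).
  - by exists b.
  - have [b' Db'] := filtration_cover fD t; exists b' => x [_ /same_gap_notin Dx].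
    by rewrite leNgt; apply: contra_notN Dx => /ltW/(filtration_mono fD); exact.
  - move=> m lm Km; split.
      by apply: (cp_closed cp) lm _ => a /Km[x [[Kx _] ax xm]]; exists x.
    move=> u tu /(filtration_limit fD lm)[a /Km[x [[_ tx] ax _]] Da].
    by apply: (tx u tu); exact: filtration_mono fD _ _ (ltW ax) _ Da.
have [_ _ p0p0] := cs _ _ p0s p0s.
exists z, p0.2; split=> //.
- exact: same_gap_notin tz.
- move: (tz) => /same_gap_sym/same_gap_notin/same_gap_refl/(p0p0 _ Kz).
  exact: same_gap_notin.
split.
- move=> p x ps Kx xz; have tx := filtration_gap fD xz tz.
  have [_ _ /(_ _ Kx) <-] := cs _ _ p0s ps.
  by split; apply: same_gap_trans => //; exact: same_gap_sym.
- move=> p x ps Kx zx /(p0P _ ps _ Kx) tx.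
  by have := zP x (conj Kx tx); rewrite leNgt zx.
- move=> p ps tp; have [-> ->] := same_gap_lt tz tp.
  by have [-> -> _] := cs _ _ p0s ps.
Qed.

(** Let [z] be the last stage where [t] shares its complementary interval with
    the first coordinate of some entry, and [l] the last stage omitting [t]. The
    value of [t] is taken in the corresponding interval of [E z], separated from
    the old values at the next stage [z'], and such that [l] is also the last
    stage omitting it. *)
Lemma clique_extend s t : clique D E K s -> (forall p, p \in s -> p.1 != t) ->
  exists y, clique D E K ((t, y) :: s).
Proof.
move=> cs ts; have cp' := closure_points_flip cp.
have [z [y0 [Kz Dzt Ezy0 [near far order_far]]]] := nearest_entry t cs.
have [z' [Kz' zz' z'P]] := cp_next cp z.
have [l [Kl Dlt lP]] := last_omitting fD cp t.
have [l' [Kl' ll' l'P]] := cp_next cp l.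
have zl : z <= l by exact: lP.
pose lo := [seq p.2 | p <- s & `[< same_gap (E z) y0 p.2 >] && (p.1 < t)].
pose hi := [seq p.2 | p <- s & `[< same_gap (E z) y0 p.2 >] && (t < p.1)].
have loP p : p \in s -> same_gap (E z) y0 p.2 -> p.1 < t -> p.2 \in lo.
  move=> ps yp pt; apply/map_f; rewrite mem_filter ps pt !andbT.
  exact/asboolP.
have hiP p : p \in s -> same_gap (E z) y0 p.2 -> t < p.1 -> p.2 \in hi.
  move=> ps yp pt; apply/map_f; rewrite mem_filter ps pt !andbT.
  exact/asboolP.
have [|||e1 [e2 [e12 [Ee1 Ee2] [ye1 ye2] loe1 e2hi]]] :=
    room fE cp' uncountable_itv (lo := lo) (hi := hi) Kz' zz' Ezy0.
- by move=> _ /mapP[p + ->]; rewrite mem_filter => /andP[/andP[/asboolP]].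
- by move=> _ /mapP[p + ->]; rewrite mem_filter => /andP[/andP[/asboolP]].
- move=> _ _ /mapP[p + ->] /mapP[q + ->]; rewrite !mem_filter.
  move=> /andP[/andP[/asboolP yp pt] ps] /andP[/andP[/asboolP yq tq] qs].
  have [<- _ pq] := cs _ _ ps qs; split; first exact: lt_trans tq.
  move=> /(pq _ Kz') /(same_gap_between (ltW pt) (ltW tq))[/same_gap_sym].
  by move=> /(far _ _ ps Kz' zz').
(* If [z = l], the value must appear at [z'], and [e1] does. Otherwise it is
   found in a complementary interval of [E l] between [e1] and [e2], which
   exists since [E l] is countable. *)
have [y [e1y ye2' Ely El'y y0y]] : exists y,
    [/\ e1 <= y, y <= e2, ~ E l y, E l' y & same_gap (E z) y0 y].
  move: zl; rewrite le_eqVlt => /orP[/eqP zl|zl].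
    exists e1; rewrite -zl; split=> //; first exact: ltW.
      exact: same_gap_notin (same_gap_sym ye1).
    by apply: filtration_mono fE _ _ _ _ Ee1; apply: z'P => //; rewrite zl.
  have z'l : z' <= l by exact: z'P.
  have [v [e1v ve2 Elv]] : exists v, [/\ e1 < v, v < e2 & ~ E l v].
    apply: contrapT => nv; apply: (uncountable_itv e12).
    apply: countable_subset (filtration_countable fE l) => v /andP[e1v ve2].
    by apply: contrapT => Elv; apply: nv; exists v.
  have [up _ _ _ _] := cp_left cp' Kl' ll'.
  have [y [El'y vy v_y]] := up v Elv.
  have Ely := same_gap_notin (same_gap_sym vy).
  have El_out e : E z' e -> ~ same_gap (E l) v e.
    move=> Ee /same_gap_sym/same_gap_notin; apply.
    exact: filtration_mono fE _ _ z'l _ Ee.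
  have ey1 : e1 < y by rewrite -(same_gap_lt vy (El_out _ Ee1)).2.
  have ey2 : y < e2 by rewrite -(same_gap_lt vy (El_out _ Ee2)).1.
  exists y; split=> //; try exact: ltW.
  have e1e2 := same_gap_trans (same_gap_sym ye1) ye2.
  have [? _] := same_gap_between (ltW ey1) (ltW ey2) e1e2.
  exact: same_gap_trans ye1 _.
have lo_y p : p \in s -> same_gap (E z) y0 p.2 -> p.1 < t ->
    p.2 < y /\ ~ same_gap (E z') y p.2.
  move=> ps yp pt; have pe1 := loe1 _ (loP _ ps yp pt).
  split; first exact: lt_le_trans e1y.
  by move=> yp'; apply: yp' Ee1; right; rewrite (ltW pe1).
have hi_y p : p \in s -> same_gap (E z) y0 p.2 -> t < p.1 ->
    y < p.2 /\ ~ same_gap (E z') y p.2.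
  move=> ps yp pt; have e2p := e2hi _ (hiP _ ps yp pt).
  split; first exact: le_lt_trans e2p.
  by move=> yp'; apply: yp' Ee2; left; rewrite ye2' ltW.
exists y; apply: clique_cons => //.
  split=> /= [||x Kx]; rewrite ?ltxx //.
  have [xl|lx] := leP x l.
    split=> _; apply: same_gap_refl.
      by apply: contra_not Ely; exact: filtration_mono fE _ _ xl _.
    by apply: contra_not Dlt; exact: filtration_mono fD _ _ xl _.
  split=> /same_gap_notin nx; case: nx.
    by apply: contrapT => /(lP _ Kx); rewrite leNgt lx.
  by apply: filtration_mono fE _ _ (l'P _ Kx lx) _ El'y.
move=> p ps.
have z'_far x : K x -> z < x -> same_gap (E x) y p.2 -> same_gap (E z') y p.2.
  by move=> Kx zx; apply: (filtration_gap fE); exact: z'P.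
have [tp|ntp] := pselect (same_gap (D z) t p.1).
  have yp : same_gap (E z) y0 p.2 by apply/(near _ _ ps Kz (lexx _)).
  have [o1 o2 nyp] : [/\ (t < p.1) = (y < p.2), (p.1 < t) = (p.2 < y) &
      ~ same_gap (E z') y p.2].
    have [pt|tp'|pt] := ltgtP p.1 t.
    - by have [py ?] := lo_y _ ps yp pt; split; rewrite ?py // ltNge ltW.
    - by have [py ?] := hi_y _ ps yp tp'; split; rewrite ?py // ltNge ltW.
    - by have := ts _ ps; rewrite pt eqxx.
  split=> //= x Kx; have [xz|zx] := leP x z.
    split=> _; last by exact: same_gap_sub (filtration_mono fD xz) tp.
    by apply: (filtration_gap fE xz); apply: same_gap_trans (same_gap_sym y0y) yp.
  by split=> [/(far _ _ ps Kx zx)|/(z'_far _ Kx zx)].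
have nyp : ~ same_gap (E z) y0 p.2 by move=> /(near _ _ ps Kz (lexx _)).
have [o1 o2] := order_far _ ps ntp; have [p1 p2] := same_gap_lt y0y nyp.
split=> /= [||x Kx]; [by rewrite o1 p1|by rewrite o2 p2|].
have [xz|zx] := leP x z.
  have y0yx := filtration_gap fE xz y0y; rewrite (near _ _ ps Kx xz).
  by split; apply: same_gap_trans => //; exact: same_gap_sym.
split=> [/(far _ _ ps Kx zx)//|/(filtration_gap fE (ltW zx)) yp].
by case: nyp; exact: same_gap_trans yp.
Qed.

End Extension.

(** * The countable chain condition *)

Section Amalgamation.
Context dX dY (X : orderType dX) (Y : orderType dY).
Variables (c : X -> Y -> nat) (D : omega1 -> set X) (E : omega1 -> set Y).
Variable (K : set omega1).
Hypotheses (cP : comonotone c) (fD : filtration D) (fE : filtration E).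
Hypotheses (cp : closure_points c D E K).

(** Let [v] be an entry of [p] and [w] one of [q] with match [u] in [p]. The
    chains link [u] and [w]. If [v] shares its complementary interval with [u] up
    to the stage [d], where [w] has appeared, then [w] is to [v] as it is to
    [u]. Otherwise [v] and [u] are apart at the stage [z], where [u] and [w] are
    not, so [w] is to [v] as [u] is to [v]. *)
Lemma amalgamate d z (p q : seq (X * Y)) : K d -> K z -> z <= d ->
  clique D E K p -> clique D E K q ->
  (forall w, w \in q -> D d w.1) ->
  (forall v w, v \in p -> w \in p -> ~ D d v.1 -> ~ D d w.1 ->
     same_gap (D z) v.1 w.1 -> same_gap (D d) v.1 w.1) ->
  (forall v, v \in p -> D d v.1 -> v \in q) ->
  (forall w, w \in q -> w \in p \/ exists v, [/\ v \in p, ~ D d v.1,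
     c v.1 v.2 = c w.1 w.2, same_gap (D z) v.1 w.1 & same_gap (E z) v.2 w.2]) ->
  clique D E K (p ++ q).
Proof.
move=> Kd Kz zd kp kq qd sep root match_q.
have qdE w : w \in q -> E d w.2 by move=> wq; apply/(linked_notin Kd (kq _ _ wq wq))/qd.
have ndE v : v \in p -> ~ D d v.1 -> ~ E d v.2.
  by move=> vp Dv /(linked_notin Kd (kp _ _ vp vp)).
have cross u w : u \in p -> w \in q -> ~ D d u.1 ->
    c u.1 u.2 = c w.1 w.2 -> linked D E K u w.
  move=> up wq Du cuw; have Eu := ndE _ up Du; have Dw := qd _ wq; have Ew := qdE _ wq.
  have n1 : u.1 != w.1 by apply: contra_notN Du => /eqP->.
  have n2 : u.2 != w.2 by apply: contra_notN Eu => /eqP->.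
  have lt1 : u.1 < w.1 -> u.2 < w.2.
    by move=> /(cP cuw); rewrite [u.2 < _]lt_neqAle n2.
  have lt2 : w.1 < u.1 -> w.2 < u.2.
    by move=> /(cP (esym cuw)); rewrite [w.2 < _]lt_neqAle eq_sym n2.
  have o : (u.1 < w.1) = (u.2 < w.2) /\ (w.1 < u.1) = (w.2 < u.2).
    have [l|l|e] := ltgtP u.1 w.1.
    - by have l' := lt1 l; rewrite l' ltNge ltW.
    - by have l' := lt2 l; rewrite l' ltNge ltW.
    - by rewrite e eqxx in n1.
  split; [exact: o.1|exact: o.2|] => x Kx.
  have [dx|xd] := leP d x.
    split=> /same_gap_sym/same_gap_notin[].
      exact: filtration_mono fD _ _ dx _ Dw.
    exact: filtration_mono fE _ _ dx _ Ew.
  have Dxu : ~ D x u.1.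
    by apply: contra_not Du; exact: filtration_mono fD _ _ (ltW xd) _.
  have Exu : ~ E x u.2.
    by apply: contra_not Eu; exact: filtration_mono fE _ _ (ltW xd) _.
  split=> g; move: (g) => /same_gap_sym/same_gap_notin nw.
    apply: (same_gap_transport (comonotone_flip cP) fE (closure_points_flip cp)
      Kx cuw) => //.
    by move=> /(linked_notin Kx (kq _ _ wq wq)).
  apply: (same_gap_transport cP fD cp Kx cuw) => //.
  by move=> /(linked_notin Kx (kq _ _ wq wq)).
have pq v w : v \in p -> w \in q -> linked D E K v w.
  move=> vp wq; have [wp|[u [up Du cuw uw1 uw2]]] := match_q _ wq; first exact: kp.
  have [Dv|Dv] := pselect (D d v.1); first by apply: kq => //; exact: root.
  have [o1 o2 guw] := cross _ _ up wq Du cuw.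
  have [vu1 vu2 vu] := kp _ _ vp up.
  have Dw := qd _ wq; have Ew := qdE _ wq.
  have [g|ng] := pselect (same_gap (D z) v.1 u.1).
    have gd := sep _ _ vp up Dv Du g; have gdE := (vu _ Kd).1 gd.
    have nDw : ~ same_gap (D d) v.1 w.1 by move=> /same_gap_sym/same_gap_notin.
    have nEw : ~ same_gap (E d) v.2 w.2 by move=> /same_gap_sym/same_gap_notin.
    have [a1 a2] := same_gap_lt gd nDw; have [b1 b2] := same_gap_lt gdE nEw.
    split; [by rewrite a1 b1|by rewrite a2 b2|] => x Kx.
    have [dx|xd] := leP d x.
      split=> /same_gap_sym/same_gap_notin[].
        exact: filtration_mono fD _ _ dx _ Dw.
      exact: filtration_mono fE _ _ dx _ Ew.
    have gx := filtration_gap fD (ltW xd) gd.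
    have gxE := filtration_gap fE (ltW xd) gdE.
    split=> h.
      apply: (same_gap_trans gxE); apply/(guw _ Kx).
      exact: same_gap_trans (same_gap_sym gx) h.
    apply: (same_gap_trans gx); apply/(guw _ Kx).
    exact: same_gap_trans (same_gap_sym gxE) h.
  have ngE : ~ same_gap (E z) v.2 u.2 by move=> /(vu _ Kz).
  have ng' : ~ same_gap (D z) u.1 v.1 by move=> /same_gap_sym.
  have ngE' : ~ same_gap (E z) u.2 v.2 by move=> /same_gap_sym.
  have [a1 a2] := same_gap_lt uw1 ng'; have [b1 b2] := same_gap_lt uw2 ngE'.
  split; [by rewrite -a2 -b2|by rewrite -a1 -b1|] => x Kx.
  have [xz|zx] := leP x z.
    have gx := filtration_gap fD xz uw1; have gxE := filtration_gap fE xz uw2.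
    split=> h.
      apply: same_gap_trans gxE; apply/(vu _ Kx).
      exact: same_gap_trans h (same_gap_sym gx).
    apply: same_gap_trans gx; apply/(vu _ Kx).
    exact: same_gap_trans h (same_gap_sym gxE).
  split=> h.
    by case: ng; apply: same_gap_trans (filtration_gap fD (ltW zx) h) (same_gap_sym uw1).
  by case: ngE; apply: same_gap_trans (filtration_gap fE (ltW zx) h) (same_gap_sym uw2).
move=> v w; rewrite !mem_cat => /orP[vp|vq] /orP[wp|wq].
- exact: kp.
- exact: pq.
- exact/linked_sym/pq.
- exact: kq.
Qed.

Lemma seq_stage (T : eqType) (Q : omega1 -> T -> Prop) d (s : seq T) :
  (exists y, y < d) -> (forall x y t, x <= y -> Q x t -> Q y t) ->
  (forall t, t \in s -> exists2 x, x < d & Q x t) ->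
  exists2 x, x < d & forall t, t \in s -> Q x t.
Proof.
move=> [y0 y0d] mono; elim: s => [|t s IH] sQ; first by exists y0.
have [x xd Qx] := sQ t (mem_head _ _).
have [|y yd Qy] := IH; first by move=> u us; apply: sQ; rewrite in_cons us orbT.
exists (Order.max x y); first by rewrite gt_max xd.
move=> u; rewrite in_cons => /orP[/eqP->|/Qy].
  by apply: mono Qx; rewrite le_max lexx.
by apply: mono; rewrite le_max lexx orbT.
Qed.

(** [r] lists the entries to be shared; [a] lists, for the other entries, a value
    of [c] and representatives of the two complementary intervals at the stage
    [z]. *)
Definition realizes (z : omega1) (r : seq (X * Y)) (a : seq (nat * (X * Y)))
    (q : seq (X * Y)) : Prop :=
  (forall v, v \in r -> v \in q) /\
  forall w, w \in q -> w \in r \/ exists2 e, e \in a &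
    [/\ e.1 = c w.1 w.2, same_gap (D z) e.2.1 w.1 & same_gap (E z) e.2.2 w.2].

Definition inside (x : omega1) (q : seq (X * Y)) : Prop :=
  forall w, w \in q -> D x w.1 /\ E x w.2.

Lemma inside_mono x y q : x <= y -> inside x q -> inside y q.
Proof.
move=> xy iq w /iq[Dw Ew].
by split; [exact: filtration_mono fD _ _ xy _ Dw|exact: filtration_mono fE _ _ xy _ Ew].
Qed.

Lemma countable_inside x : countable [set q | inside x q].
Proof.
apply: countable_subset (countable_seqs (countableX (filtration_countable fD x)
  (filtration_countable fE x))).
by move=> q iq w /iq.
Qed.

(** The values of [c] are left free: there are only countably many of them. *)
Definition inside_data (x : omega1) (a : seq (nat * (X * Y))) : Prop :=
  forall e, e \in a -> D x e.2.1 /\ E x e.2.2.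

(** The clause on [K] makes a limit of such stages a limit of closure points. *)
Definition reflects (W : set (seq (X * Y))) (x y : omega1) : Prop :=
  (exists2 k, K k & x < k < y) /\
  forall z r a, z <= x -> inside x r -> inside_data x a ->
    (exists2 q, W q & realizes z r a q) ->
    exists q, [/\ W q, realizes z r a q & inside y q].

Lemma reflects_mono W x y y' : y <= y' -> reflects W x y -> reflects W x y'.
Proof.
move=> yy' [[k Kk /andP[xk ky]] H]; split.
  by exists k => //; rewrite xk (lt_le_trans ky).
move=> z r a zx ir ia /(H _ _ _ zx ir ia)[q [Wq rq iq]]; exists q; split=> //.
exact: inside_mono iq.
Qed.

(** There are countably many data inside the stage [x]; pick a witness for each. *)
Lemma reflects_ex (W : set (seq (X * Y))) x : exists y, reflects W x y.
Proof.
pose T := (omega1 * (seq (X * Y) * seq (nat * (X * Y))))%type.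
pose A := [set t : T | [/\ t.1 <= x, inside x t.2.1 & inside_data x t.2.2]].
have cA : countable A.
  apply: (@countable_subset _ _ ([set y | y <= x] `*`
    ([set q | inside x q] `*` [set a | inside_data x a]))%classic).
    by move=> [t [r a]] [].
  apply: countableX; first exact: omega1_countable_le.
  apply: countableX; first exact: countable_inside.
  apply: countable_subset (countable_seqs (countableX (countableP [set: nat])
    (countableX (filtration_countable fD x) (filtration_countable fE x)))).
  by move=> a ia e /ia[? ?].
have inside_ex q : exists y, inside y q.
  elim: q => [|w q [y iq]]; first by exists x.
  have [y1 Dy1] := filtration_cover fD w.1; have [y2 Ey2] := filtration_cover fE w.2.
  exists (Order.max y (Order.max y1 y2)) => v; rewrite in_cons => /orP[/eqP->|vq].
    split; [apply: filtration_mono fD _ _ _ _ Dy1|apply: filtration_mono fE _ _ _ _ Ey2];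
      by rewrite !le_max lexx ?orbT.
  by apply: (inside_mono _ iq) vq; rewrite le_max lexx.
have /choice[f fP] : forall t : T, exists y,
    (exists2 q, W q & realizes t.1 t.2.1 t.2.2 q) ->
    exists q, [/\ W q, realizes t.1 t.2.1 t.2.2 q & inside y q].
  move=> t; have [[q Wq rq]|n] := pselect (exists2 q, W q & realizes t.1 t.2.1 t.2.2 q).
    by have [y iy] := inside_ex q; exists y => _; exists q.
  by exists x.
have [b bP] := omega1_bounded (countable_image f cA).
have [k Kk xk] := cp_unbounded cp x; have [y ky] := omega1_above k.
exists (Order.max y b); split.
  by exists k => //; rewrite xk lt_max ky.
move=> z r a zx ir ia ex; have [q [Wq rq iq]] := fP (z, (r, a)) ex.
exists q; split=> //; apply: inside_mono iq; rewrite le_max; apply/orP; right.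
by apply/ltW/bP; exists (z, (r, a)).
Qed.

(** Let [p] be a member of [W] not inside a closure point [d] that reflects [W].
    The closure properties of [d] provide data inside [d] realized by [p] at a
    stage [z] below [d], and reflection a member [q] of [W] which is inside [d]
    and realizes them too. *)
Lemma cliques_ccc (W : set (seq (X * Y))) : W `<=` clique D E K -> ~ countable W ->
  exists p q, [/\ W p, W q, p <> q & clique D E K (p ++ q)].
Proof.
move=> Wk ncW.
have [b Kb _] := cp_bottom cp.
have [d [ld bd Phid]] := closing_off (reflects_ex W) (@reflects_mono W) b.
have Kd : K d.
  by apply: (cp_closed cp ld) => x /Phid[[k Kk /andP[xk kd]] _]; exists k.
have [p Wp nip] : exists2 p, W p & ~ inside d p.
  apply: contrapT => np; apply: ncW; apply: countable_subset (countable_inside d).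
  by move=> p Wp; apply: contrapT => nip; apply: np; exists p.
have kp := Wk _ Wp.
have dE v : v \in p -> D d v.1 <-> E d v.2.
  by move=> vp; apply: linked_notin Kd _; exact: kp.
have lt_d : exists y, y < d by exists b.
(* The point of [D d] which separates two entries of [p] is in an earlier stage;
   [z0] is one which serves all pairs. *)
have [z0 z0d z0P] : exists2 z, z < d & forall v, v \in p -> forall w, w \in p ->
    ~ D d v.1 -> ~ D d w.1 -> same_gap (D z) v.1 w.1 -> same_gap (D d) v.1 w.1.
  apply: seq_stage => //.
    by move=> x y v xy H w wp Dv Dw /(filtration_gap fD xy); exact: H.
  move=> v vp; apply: seq_stage => //.
    by move=> x y w xy H Dv Dw /(filtration_gap fD xy); exact: H.
  move=> w wp; have [g|ng] := pselect (same_gap (D d) v.1 w.1); first by exists b.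
  have [u [vuw Du]] : exists u,
      (v.1 <= u <= w.1 \/ w.1 <= u <= v.1) /\ D d u.
    by apply: contrapT => nu; apply: ng => u uvw Du; apply: nu; exists u.
  have [x xd Dxu] := filtration_limit fD ld Du.
  by exists x => // _ _ /(_ _ vuw).
have [[z Kz /andP[z0z zd]] _] := Phid _ z0d.
have [up _ _ _ _] := cp_left cp Kd zd; have [upE _ _ _ _] := cp_right cp Kd zd.
have /choice[f fP] : forall v : X * Y, exists e : X * Y, ~ D d v.1 -> ~ E d v.2 ->
    [/\ D d e.1, E d e.2, same_gap (D z) v.1 e.1 & same_gap (E z) v.2 e.2].
  move=> v; have [[Dv Ev]|n] := pselect (~ D d v.1 /\ ~ E d v.2); last first.
    by exists v => Dv Ev; case: n.
  have [|g [Dg vg _]] := up v.1.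
    by apply: contra_not Dv; exact: filtration_mono fD _ _ (ltW zd) _.
  have [|h [Eh vh _]] := upE v.2.
    by apply: contra_not Ev; exact: filtration_mono fE _ _ (ltW zd) _.
  by exists (g, h).
pose r := [seq v <- p | `[< D d v.1 >]].
pose a := [seq (c v.1 v.2, f v) | v <- p & ~~ `[< D d v.1 >]].
have a_mem e : e \in a -> exists v, [/\ v \in p, ~ D d v.1 & e = (c v.1 v.2, f v)].
  by move=> /mapP[v]; rewrite mem_filter => /andP[/asboolPn Dv vp] ->; exists v.
have nE v : v \in p -> ~ D d v.1 -> ~ E d v.2 by move=> /dE h; apply: contra_not => /h.
have two (u : X) (v : Y) : D d u -> E d v -> exists2 x, x < d & D x u /\ E x v.
  move=> /(filtration_limit fD ld)[x xd Du] /(filtration_limit fE ld)[y yd Ev].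
  exists (Order.max x y); first by rewrite gt_max xd.
  split; [apply: filtration_mono fD _ _ _ _ Du|apply: filtration_mono fE _ _ _ _ Ev];
    by rewrite le_max lexx ?orbT.
have DEmono x y (u : X) (v : Y) : x <= y -> D x u /\ E x v -> D y u /\ E y v.
  move=> xy [Du Ev].
  by split; [exact: filtration_mono fD _ _ xy _ Du|exact: filtration_mono fE _ _ xy _ Ev].
have [x1 x1d ir] : exists2 x, x < d & inside x r.
  apply: (@seq_stage _ (fun x w => D x w.1 /\ E x w.2)) => //.
    by move=> x y w; exact: DEmono.
  move=> w; rewrite mem_filter => /andP[/asboolP Dw wp]; apply: two => //.
  exact/dE.
have [x2 x2d ia] : exists2 x, x < d & inside_data x a.
  apply: (@seq_stage _ (fun x e => D x e.2.1 /\ E x e.2.2)) => //.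
    by move=> x y e; exact: DEmono.
  move=> e /a_mem[v [vp Dv ->]].
  by have [Df Ef _ _] := fP v Dv (nE _ vp Dv); exact: two.
pose x := Order.max z (Order.max x1 x2).
have xd : x < d by rewrite !gt_max zd x1d.
have zx : z <= x by rewrite le_max lexx.
have [_ refl] := Phid _ xd.
have [|||q [Wq [rq qr] iq]] := refl z r a zx.
- by apply: inside_mono ir; rewrite !le_max lexx ?orbT.
- by move=> e /ia; apply: DEmono; rewrite !le_max lexx ?orbT.
- exists p => //; split=> [v|w wp]; first by rewrite mem_filter => /andP[].
  have [Dw|Dw] := pselect (D d w.1).
    by left; rewrite mem_filter wp andbT; exact/asboolP.
  have [_ _ g1 g2] := fP w Dw (nE _ wp Dw).
  right; exists (c w.1 w.2, f w).
    by apply/map_f; rewrite mem_filter wp andbT; exact/asboolPn.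
  by split=> //=; exact: same_gap_sym.
exists p, q; split=> //; first by move=> pq; apply: nip; rewrite pq.
apply: (@amalgamate d z) => //; first exact: ltW.
- exact: Wk.
- by move=> w /iq[].
- by move=> v w vp wp Dv Dw /(filtration_gap fD (ltW z0z)); exact: z0P.
- by move=> v vp Dv; apply: rq; rewrite mem_filter vp andbT; exact/asboolP.
move=> w /qr[|[e /a_mem[v [vp Dv ->]] /= [cvw g1 g2]]].
  by rewrite mem_filter => /andP[_ wp]; left.
have [_ _ h1 h2] := fP v Dv (nE _ vp Dv).
by right; exists v; split=> //; [exact: same_gap_trans h1 g1|exact: same_gap_trans h2 g2].
Qed.

End Amalgamation.

(** * The isomorphism given by Martin's axiom *)

Section Conditions.
Context dX dY (X : orderType dX) (Y : orderType dY).
Variables (D : omega1 -> set X) (E : omega1 -> set Y) (K : set omega1).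

Definition condition : Type := {s : seq (X * Y) | `[< clique D E K s >]}.

HB.instance Definition _ := SubChoice.on condition.

Definition condition_le (p q : condition) : bool := all (mem (val p)) (val q).

Lemma condition_leP p q : reflect {subset val q <= val p} (condition_le p q).
Proof. exact: allP. Qed.

Lemma condition_le_refl : reflexive condition_le.
Proof. by move=> p; apply/condition_leP. Qed.

Lemma condition_le_trans : transitive condition_le.
Proof.
by move=> q p r /condition_leP pq /condition_leP qr; apply/condition_leP => z /qr/pq.
Qed.

HB.instance Definition _ := Order.Le_isPreorder.Build (Order.Disp tt tt) condition
  condition_le_refl condition_le_trans.

Lemma condition_clique (p : condition) : clique D E K (val p).
Proof. exact/asboolP/(valP p). Qed.

Definition mk_condition s (ks : clique D E K s) : condition :=
  exist _ s (introT (asboolP _) ks).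

Definition defined_at (e : X + Y) : set condition :=
  match e with
  | inl x => [set p | exists y, (x, y) \in val p]
  | inr y => [set p | exists x, (x, y) \in val p]
  end.

End Conditions.

Section Isomorphism.
Context dX dY (X : orderType dX) (Y : orderType dY).
Variables (c : X -> Y -> nat) (cX : X -> X -> nat) (cY : Y -> Y -> nat).
Variables (D : omega1 -> set X) (E : omega1 -> set Y).
Hypotheses (cP : comonotone c) (cXP : comonotone cX) (cYP : comonotone cY).
Hypotheses (fD : filtration D) (fE : filtration E).
Hypothesis uncountable_itvX : forall a b : X, a < b -> ~ countable [set t | a < t < b].
Hypothesis uncountable_itvY : forall a b : Y, a < b -> ~ countable [set t | a < t < b].

(** The dense sets ask that each point of [X] have a value and each point of [Y]
    be one. A filter being directed, any two entries of its members are linked,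
    which makes the two functions read off from it monotone and inverse to each
    other. *)
Lemma MA_iso : MA_aleph1 -> X -> Y -> iso X Y.
Proof.
move=> MA x0 y0; have [K cp] := closure_points_ex c cXP cYP fD fE.
pose P := condition D E K.
have P0 : [set: P] !=set0.
  by exists (mk_condition (clique_nil D E K)).
have cccP : ccc P.
  move=> W antiW; apply: contrapT => ncW.
  have [_ [_ [[p Wp <-] [q Wq <-] npq kpq]]] :
      exists p q, [/\ (val @` W) p, (val @` W) q, p <> q & clique D E K (p ++ q)].
    apply: (cliques_ccc cP fD fE cp).
      by move=> _ [p _ <-]; exact: condition_clique.
    by rewrite (eq_countable (inj_card_eq (in2W val_inj))).
  apply: npq; congr val; apply: antiW => //; exists (mk_condition kpq).
    by apply/condition_leP => z /= zp; rewrite mem_cat zp.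
  by apply/condition_leP => z /= zp; rewrite mem_cat zp orbT.
have dense_at e : forcing_dense (@defined_at _ _ X Y D E K e).
  move=> p; have kp := condition_clique (p := p); case: e => [x|y] /=.
    have [[y xy]|nx] := pselect (exists y, (x, y) \in val p).
      by exists p; [exists y|exact: lexx].
    have [|y ky] := clique_extend fD fE cp uncountable_itvY y0 kp (t := x).
      move=> z zp; apply/eqP => zx; apply: nx; exists z.2.
      by rewrite -zx -surjective_pairing.
    exists (mk_condition ky); first by exists y; exact: mem_head.
    by apply/condition_leP => z /= zp; rewrite in_cons zp orbT.
  have [[x xy]|ny] := pselect (exists x, (x, y) \in val p).
    by exists p; [exists x|exact: lexx].
  have [|x kx] := clique_extend fE fD (closure_points_flip cp) uncountable_itvX x0
      (clique_flip kp) (t := y).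
    move=> _ /mapP[z zp ->]; apply/eqP => /= zy; apply: ny; exists z.1.
    by rewrite -zy -surjective_pairing.
  have kx' : clique D E K ((x, y) :: val p).
    have := clique_flip kx; rewrite /= -map_comp.
    by rewrite (eq_map (g := id)) ?map_id // => -[].
  exists (mk_condition kx'); first by exists x; exact: mem_head.
  by apply/condition_leP => z /= zp; rewrite in_cons zp orbT.
have [||G [[p0 Gp0] Gup Gdir] Gmeet] :=
    MA _ P P0 cccP [set A | exists e, A = @defined_at _ _ X Y D E K e].
- apply: (@card_le_trans _ _ _ [set: X + Y]).
    have -> : [set A | exists e, A = @defined_at _ _ X Y D E K e] =
        @defined_at _ _ X Y D E K @` [set: X + Y].
      by apply/seteqP; split=> A /= [e]; [move=> ->; exists e|move=> _ <-; exists e].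
    exact: card_image_le.
  apply: (@card_le_omega1 _ (fun x => inl @` D x `|` inr @` E x)%classic).
    move=> x; apply: countableU; apply: countable_image.
      exact: filtration_countable fD x.
    exact: filtration_countable fE x.
  apply/seteqP; split=> // -[t|t] _.
    by have [x Dx] := filtration_cover fD t; exists x => //; left; exists t.
  by have [x Ex] := filtration_cover fE t; exists x => //; right; exists t.
- by move=> _ [e ->]; exact: dense_at.
have /choice[f fP] : forall x, exists y, exists2 p, G p & (x, y) \in val p.
  move=> x; have [|p [Gp [y xy]]] := Gmeet (@defined_at _ _ X Y D E K (inl x)).
    by exists (inl x).
  by exists y, p.
have /choice[g gP] : forall y, exists x, exists2 p, G p & (x, y) \in val p.
  move=> y; have [|p [Gp [x xy]]] := Gmeet (@defined_at _ _ X Y D E K (inr y)).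
    by exists (inr y).
  by exists x, p.
have G_linked u v : (exists2 p, G p & u \in val p) -> (exists2 p, G p & v \in val p) ->
    linked D E K u v.
  move=> [p Gp up] [q Gq vq].
  have [r Gr [/condition_leP rp /condition_leP rq]] := Gdir _ _ Gp Gq.
  by apply: (condition_clique (p := r)); [exact: rp|exact: rq].
exists f; split.
  move=> x x'; have [_ h _] := G_linked _ _ (fP x) (fP x').
  by rewrite !leNgt /= h.
exists g.
  move=> x; have [h1 h2 _] := G_linked _ _ (fP x) (gP (f x)).
  by move: h1 h2; rewrite /= ltxx; case: ltgtP.
move=> y; have [h1 h2 _] := G_linked _ _ (fP (g y)) (gP y).
by move: h1 h2; rewrite /= ltxx; case: ltgtP.
Qed.

End Isomorphism.

(** * Countryman lines and their lexicographic multiples *)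

Lemma countryman_comonotone d (C : orderType d) : countryman C ->
  exists c : C -> C -> nat, comonotone c.
Proof.
move=> [_ [F [chainF covF]]].
have /choice[c cF] : forall p : C *p C, exists n, F n p.
  by move=> p; have : [set: C *p C] p by []; rewrite -covF => -[n _ Fp]; exists n.
exists (fun x y => c (x, y)) => x x' y y' e xx'.
have := chainF _ _ _ (cF (x, y)); rewrite e => /(_ _ (cF (x', y'))).
rewrite /Order.comparable !leEprod /= [x' <= x]leNgt xx' /= orbF.
by case/andP.
Qed.

Lemma dense_uncountable d (C : orderType d) : aleph1_dense C ->
  forall a b : C, a < b -> ~ countable [set t | a < t < b].
Proof.
move=> [_ _ dC] a b ab cab; apply: (negP omega1_uncountable).
rewrite -(eq_countable (dC _ _ ab)).
apply: (@countable_subset _ _ ([set a] `|` ([set b] `|` [set t | a < t < b]))%classic).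
  move=> t /andP[]; rewrite !le_eqVlt => /orP[/eqP->|at_]; first by left.
  by case/orP => [/eqP->|tb]; right; [left|right; rewrite /= at_].
by do 2 (apply: countableU; first exact: countable1).
Qed.

Lemma no_endpoints_above d (C : orderType d) (I : set C) t :
  no_endpoints I -> I t -> exists2 u, I u & t < u.
Proof.
move=> [_ no] It; apply: contrapT => nu; suff : (set0 : set C) t by [].
rewrite -no; split=> // u Iu; rewrite leNgt; apply/negP => tu.
by apply: nu; exists u.
Qed.

Lemma no_endpoints_below d (C : orderType d) (I : set C) t :
  no_endpoints I -> I t -> exists2 u, I u & u < t.
Proof.
move=> [no _] It; apply: contrapT => nu; suff : (set0 : set C) t by [].
rewrite -no; split=> // u Iu; rewrite leNgt; apply/negP => ut.
by apply: nu; exists u.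
Qed.

Lemma complementary_same_gap d (C : orderType d) (D : set C) t : ~ D t ->
  complementary_interval D (same_gap D t).
Proof.
move=> Dt; split; first split.
- by exists t; exact: same_gap_refl.
- move=> u v w /= tu tw /andP[uv vw]; apply: (same_gap_trans tu).
  by have [] := same_gap_between uv vw (same_gap_trans (same_gap_sym tu) tw).
- by apply/seteqP; split=> // u [/same_gap_sym/same_gap_notin].
move=> J [_ convJ JD] IJ; apply/seteqP; split=> // u Ju v tuv Dv.
have Jt : J t by apply: IJ; exact: same_gap_refl.
suff : (set0 : set C) v by [].
by rewrite -JD; split=> //; case: tuv; exact: convJ.
Qed.

(** Emptying the first stage turns a decomposition into a filtration: its only
    complementary interval there is the whole line. *)
Lemma normal_filtration d (C : orderType d) : normal C ->
  exists D : omega1 -> set C, filtration D.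
Proof.
move=> [[D [[cD monoD covD limD] noD]] [_ noC _]].
pose D' x := [set t | D x t /\ exists y, y < x].
have gapI x t : ~ D' x t -> exists I : set C,
    [/\ no_endpoints I, I t & I `<=` same_gap (D' x) t].
  move=> nDt; have [[z zx]|nz] := pselect (exists z, z < x).
    have Dt : ~ D x t by move=> Dt; apply: nDt; split=> //; exists z.
    exists (same_gap (D x) t); split; [|exact: same_gap_refl|].
      exact: noD _ _ (complementary_same_gap Dt).
    by move=> u; apply: same_gap_sub => v [].
  by exists setT; split=> // u _ v _ [_].
exists D'; split.
- by move=> x; apply: countable_subset (cD x) => t [].
- move=> x y xy t [Dt [z zx]]; split; first exact: monoD xy _ Dt.
  by exists z; exact: lt_le_trans xy.
- move=> t; have : [set: C] t by []; rewrite -covD => -[x _ Dt].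
  have [y xy] := omega1_above x; exists y; split; last by exists x.
  exact: monoD (ltW xy) _ Dt.
- move=> x t lx [Dt _]; move: Dt; rewrite (limD _ lx) => -[y yx Dt].
  have [z yz zx] := lx.2 _ yx; exists z => //; split; last by exists y.
  exact: monoD (ltW yz) _ Dt.
- by move=> x t xb [_ [y]]; rewrite ltNge xb.
- move=> x t /gapI[I [noI It Igap]]; have [u Iu tu] := no_endpoints_above noI It.
  by exists u => //; exact: Igap.
- move=> x t /gapI[I [noI It Igap]]; have [u Iu tu] := no_endpoints_below noI It.
  by exists u => //; exact: Igap.
Qed.

Section LexicographicProduct.
Context d d' (A : orderType d') (C : orderType d).
Variables (f : A -> C) (c : C -> C -> nat) (D : omega1 -> set C).
Hypotheses (f_mono : {homo f : a b / a < b}) (cP : comonotone c) (fD : filtration D).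

Lemma ltlexi (p q : A *l C) : p < q -> p.1 < q.1 \/ p.1 = q.1 /\ p.2 < q.2.
Proof.
by rewrite ltEprodlexi; case: (ltgtP p.1 q.1) => //= [_|e pq]; [left|right].
Qed.

(** Pairing the levels of both coordinates works since an increase of [p] is an
    increase of one coordinate, with [y] on the other side in either case. *)
Lemma comonotone_lexi_left :
  comonotone (fun (p : A *l C) (y : C) => pickle (c (f p.1) y, c p.2 y)).
Proof.
move=> p p' y y' /(pcan_inj pickleK)[e1 e2] /ltlexi[/f_mono|[_]]; exact: cP.
Qed.

(** With all four levels, an increase of [p] forces both coordinates of [q] to be
    weakly increasing, hence [q] too. *)
Lemma comonotone_lexi : comonotone (fun p q : A *l C =>
  pickle ((c (f p.1) (f q.1), c p.2 (f q.1)), (c (f p.1) q.2, c p.2 q.2))).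
Proof.
move=> p p' q q' /(pcan_inj pickleK)[e1 e2 e3 e4] pp'.
have fq : f q.1 <= f q'.1 by move: pp' => /ltlexi[/f_mono|[_]]; exact: cP.
have q2 : q.2 <= q'.2 by move: pp' => /ltlexi[/f_mono|[_]]; exact: cP.
rewrite leEprodlexi q2 implybT andbT leNgt; apply/negP => /f_mono.
by rewrite ltNge fq.
Qed.

(** Points with the same first coordinate have only such points in between. *)
Lemma same_gap_lexi x a (k l : C) :
  (~ D x (f a) \/ same_gap (D x) k l) ->
  same_gap [set p : A *l C | D x (f p.1) /\ D x p.2] (a, k) (a, l).
Proof.
move=> gap p between [Dp1 Dp2].
have [pa pkl] : p.1 = a /\ (k <= p.2 <= l \/ l <= p.2 <= k).
  case: between => /andP[]; rewrite !leEprodlexi /= => /andP[h1 h2] /andP[h3 h4].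
    have pa : p.1 = a by apply/le_anti; rewrite h1 h3.
    by move: h2 h4; rewrite pa lexx /= => -> ->; split=> //; left.
  have pa : p.1 = a by apply/le_anti; rewrite h1 h3.
  by move: h2 h4; rewrite pa lexx /= => -> ->; split=> //; right.
by case: gap => [|/(_ _ pkl)]; rewrite -?pa.
Qed.

(** A complementary interval at a stage [x] is open-ended already within a copy
    of [C]: the copy of [a] is wholly omitted when [f a] is not in [D x], and
    otherwise it is cut by [D x] like [C]. *)
Lemma filtration_lexi :
  filtration (fun x => [set p : A *l C | D x (f p.1) /\ D x p.2]).
Proof.
have [b bP] := omega1_bottom.
have Db t : ~ D b t by exact: filtration_bottom fD _ _ bP.
have f_inj : injective f.
  by move=> x y e; case: (ltgtP x y) => // /f_mono; rewrite e ltxx.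
split.
- move=> x.
  have cD := filtration_countable fD x.
  have /countable_injP[i i_inj] := countableX cD cD.
  apply/countable_injP; exists (fun p : A *l C => i (f p.1, p.2)).
  move=> [a k] [a' k'] /set_mem[/= Da Dk] /set_mem[/= Da' Dk'] /i_inj.
  by rewrite !inE => /(_ (conj Da Dk) (conj Da' Dk'))[/f_inj -> ->].
- by move=> x y xy p [D1 D2]; split; exact: filtration_mono fD _ _ xy _ _.
- move=> [a k]; have [x Dx] := filtration_cover fD (f a).
  have [y Dy] := filtration_cover fD k.
  exists (Order.max x y); split; [apply: filtration_mono fD _ _ _ _ Dx|
    apply: filtration_mono fD _ _ _ _ Dy]; by rewrite le_max lexx ?orbT.
- move=> x [a k] lx [].
  move=> /(filtration_limit fD lx)[y yx Dy] /(filtration_limit fD lx)[z zx Dz].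
  exists (Order.max y z); first by rewrite gt_max yx.
  split; [apply: filtration_mono fD _ _ _ _ Dy|
    apply: filtration_mono fD _ _ _ _ Dz]; by rewrite le_max lexx ?orbT.
- by move=> x p xb [D1 _]; exact: filtration_bottom fD _ _ xb D1.
- move=> x [a k] /= nD; have [Dk|/(filtration_above fD)[l kl gap]] := pselect (D x k).
    have [l kl _] := filtration_above fD (Db k).
    exists ((a, l) : A *l C); first by rewrite ltEprodlexi /= lexx.
    by apply: same_gap_lexi; left=> Da; apply: nD.
  exists ((a, l) : A *l C); first by rewrite ltEprodlexi /= lexx.
  by apply: same_gap_lexi; right.
move=> x [a k] /= nD; have [Dk|/(filtration_below fD)[l kl gap]] := pselect (D x k).
  have [l kl _] := filtration_below fD (Db k).
  exists ((a, l) : A *l C); first by rewrite ltEprodlexi /= lexx.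
  by apply: same_gap_lexi; left=> Da; apply: nD.
exists ((a, l) : A *l C); first by rewrite ltEprodlexi /= lexx.
by apply: same_gap_lexi; right.
Qed.

Hypothesis uncountable_itv : forall a b : C, a < b -> ~ countable [set t | a < t < b].

Lemma uncountable_lexi (p q : A *l C) : p < q -> ~ countable [set r | p < r < q].
Proof.
have [b bP] := omega1_bottom.
have Db t : ~ D b t by exact: filtration_bottom fD _ _ bP.
have fibre a k l : k < l -> (forall t, k < t < l -> p < ((a, t) : A *l C) < q) ->
    ~ countable [set r | p < r < q].
  move=> kl sub cpq; apply: (uncountable_itv kl).
  apply: (@countable_subset _ _ (snd @` [set r : A *l C | p < r < q])).
    by move=> t /sub; exists (a, t).
  exact: countable_image.
move=> /ltlexi[pq|[pq1 pq2]].
  have [l pl _] := filtration_above fD (Db p.2).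
  apply: (fibre p.1 _ _ pl) => t /andP[pt _].
  rewrite !ltEprodlexi /= lexx pt /= (ltW pq).
  by rewrite leNgt pq.
apply: (fibre p.1 _ _ pq2) => t /andP[pt tq].
by rewrite !ltEprodlexi /= -pq1 lexx pt tq.
Qed.

End LexicographicProduct.

Theorem corollary3p2 (hMA : MA_aleph1) (d : Order.disp_t) (C : orderType d)
    (hC : countryman C) (hN : normal C) :
  (forall (d' : Order.disp_t) (A : orderType d'),
     [set: A] !=set0 -> embeds A C -> iso (A *l C) C) /\
  strongly_surjective C.
Proof.
have multiple (d' : Order.disp_t) (A : orderType d') :
    [set: A] !=set0 -> embeds A C -> iso (A *l C) C.
  move=> [a0 _] [f [f_homo f_inj]].
  have f_mono : {homo f : a b / a < b}.
    move=> a b ab; rewrite lt_neqAle f_homo ?(ltW ab) // andbT.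
    by apply/eqP => /f_inj e; rewrite e ltxx in ab.
  have [c cP] := countryman_comonotone hC; have [D fD] := normal_filtration hN.
  have unc := dense_uncountable hN.2; have [[k0 _] _ _] := hN.2.
  exact: (MA_iso (comonotone_lexi_left f_mono cP) (comonotone_lexi f_mono cP) cP
    (filtration_lexi f_mono fD) fD (uncountable_lexi fD unc) unc hMA (a0, k0) k0).
(* The multiple by [B] maps onto [B] by the first projection. *)
split=> // B; have [B0|nB] := pselect ([set: set_type B] = set0); [by left|right].
have [||g [g_mono [h gh hg]]] := multiple _ (set_type B).
- exact/set0P/eqP.
- by exists val; split; [move=> x y|exact: val_inj].
exists (fun t => (h t).1); split.
  move=> t u tu; have : h t <= h u by rewrite -g_mono !hg.
  by rewrite leEprodlexi => /andP[].
have [[k0 _] _ _] := hN.2.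
by move=> b; exists (g (b, k0)); rewrite gh.
Qed.
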